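(* Let $n\geq 12$ be even and let $l$ be the smallest positive odd number such that $R_l>3\times 2^{\frac{n-l-1}{2}}-2$. Among all crg trees on $n$ vertices, the distance between center and subtree core is maximized by the tree $T_{rg}^{n,l}$; that is, for every odd $m$ with $3\leq m<n$, $$d_{T_{rg}^{n,m}}\big(C(T_{rg}^{n,m}),S_c(T_{rg}^{n,m})\big)\leq d_{T_{rg}^{n,l}}\big(C(T_{rg}^{n,l}),S_c(T_{rg}^{n,l})\big).$$
   Context: All graphs are finite, simple, connected and undirected. A pendant vertex is a vertex of degree $1$. A binary tree is a tree in which every non-pendant vertex has degree $3$. Center and subtree core: the eccentricity of $v\in V(T)$ is $e(v)=\max_{u}d_T(u,v)$; the center $C(T)$ is the set of vertices of minimum eccentricity. A subtree of $T$ is a (nonempty) connected subgraph of $T$; $f_T(v)$ is the number of subtrees of $T$ containing $v$; the subtree core $S_c(T)$ is the set of vertices $v$ for which $f_T(v)$ is maximum. For $X,Y\subseteq V(T)$, $d_T(X,Y)=\min\{d_T(x,y):x\in X,y\in Y\}$. Rooted binary trees: a rooted binary tree is a rooted tree whose root has degree $2$ and in which every other vertex has degree $1$ or $3$; the single-vertex rooted tree is also allowed. The height (level) of a vertex is its distance to the root. A rooted binary tree is ordered if the vertices of each level $l\ge 1$ are linearly ordered so that two vertices at level $l+1$ with different parents are ordered as their parents are at level $l$. A rooted binary tree is rgood if (i) the heights of any two of its pendant vertices differ by at most $1$, and (ii) it can be ordered so that the parents of the pendant vertices at the highest level form a final segment in the ordering of the vertices at the next-to-highest level. For each odd $l$ there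 is, up to isomorphism, exactly one rgood binary tree on $l$ vertices, denoted $T_{rg}^l$. For odd $l$, $R_l=f_{T_{rg}^l}(r)$, where $r$ is the root of $T_{rg}^l$. Crg trees: a binary caterpillar is a binary tree having a path such that every vertex not on the path is adjacent to a vertex of the path. For even $n\ge 4$ and odd $l$ with $3\le l<n$, the crg tree $T_{rg}^{n,l}$ is the tree on $n$ vertices obtained by identifying the root of $T_{rg}^l$ with a vertex of maximum eccentricity of a binary caterpillar on $n-l+1$ vertices. *)

(* Defs.v *)
From mathcomp Require Import all_boot all_order zify.
From Stdlib Require Import ClassicalEpsilon.

Set Implicit Arguments.
Unset Strict Implicit.
Unset Printing Implicit Defensive.

(** * Finite simple graphs *)

Record sgraph := SGraph {
  vertex :> finType;
  edge : rel vertex;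
  edge_sym : symmetric edge;
  edge_irr : irreflexive edge }.

Section Graph.
Variable G : sgraph.
Implicit Types (u v x y : G) (X Y : {set G}) (P : {set G} * {set {set G}}).

Definition degree v := #|[set u | edge v u]|.

Definition pendant v := degree v == 1.

(* A cycle of length 2 in the sense of [cycle] is an edge walked back and
   forth; every uniq cycle with at least 3 vertices is forbidden. *)
Definition is_tree : Prop :=
  [/\ 0 < #|G|,
      forall x y, connect (@edge G) x y
    & forall c : seq G, cycle (@edge G) c -> uniq c -> size c < 3].

Definition binary_tree : Prop :=
  is_tree /\ forall v, ~~ pendant v -> degree v = 3.

(* Distances in a connected graph are < #|G|, so the neutral element #|G| of
   the minimum is never reached there. *)
Definition walk_of_length x y (k : nat) : bool :=
  [exists p : k.-tuple G, path (@edge G) x p && (last x p == y)].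

Definition dist x y : nat :=
  \big[minn/#|G|]_(k < #|G| | walk_of_length x y k) k.

Definition set_dist X Y : nat :=
  \big[minn/#|G|]_(x in X) \big[minn/#|G|]_(y in Y) dist x y.

Definition ecc v : nat := \max_(u : G) dist u v.

Definition center : {set G} := [set v | [forall u, ecc v <= ecc u]].

(* A subgraph is given by its vertex set and its set of edges, an edge being
   the set of its two end points. *)
Definition subgraph P : bool :=
  [forall A in P.2,
     exists x in P.1, exists y in P.1, edge x y && (A == [set x; y])].

Definition subgraph_edge P : rel G := fun x y => [set x; y] \in P.2.

Definition subtree P : bool :=
  [&& P.1 != set0, subgraph P
    & [forall x in P.1, forall y in P.1, connect (subgraph_edge P) x y]].

Definition num_subtrees v : nat := #|[set P | subtree P & v \in P.1]|.

Definition subtree_core : {set G} :=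
  [set v | [forall u, num_subtrees u <= num_subtrees v]].

Definition center_core_dist : nat := set_dist center subtree_core.

Definition binary_caterpillar : Prop :=
  binary_tree /\
  exists x (p : seq G),
    [/\ path (@edge G) x p, uniq (x :: p)
      & forall v, v \notin x :: p -> exists2 u, u \in x :: p & edge u v].

End Graph.

(** * Rooted binary trees *)

Record pointed_graph := PointedGraph {
  pgraph :> sgraph;
  point : pgraph }.

Section Rooted.
Variable T : pointed_graph.
Implicit Types (u v x y : T).

Definition rooted_binary_tree : Prop :=
  is_tree T /\
  (#|T| = 1 \/
   degree (point T) = 2 /\
   forall v, v != point T -> degree v = 1 \/ degree v = 3).

Definition level v : nat := dist (point T) v.

Definition highest_level : nat := \max_(v : T) level v.

Definition parent u v : bool := edge u v && (level v == (level u).+1).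

(* [le x y] only matters for x and y on a common level >= 1. *)
Definition tree_order (le : rel T) : Prop :=
  (forall l, 1 <= l ->
     [/\ {in [pred v | level v == l] &, total le},
         {in [pred v | level v == l] &, antisymmetric le}
       & {in [pred v | level v == l] & &, transitive le}]) /\
  (forall l u v x y, 1 <= l -> level x = l.+1 -> level y = l.+1 ->
     parent u x -> parent v y -> u != v -> le x y = le u v).

Definition top_pendant_parent u : bool :=
  [exists v, [&& pendant v, level v == highest_level & parent u v]].

Definition rgood : Prop :=
  [/\ rooted_binary_tree,
      forall u v, pendant u -> pendant v -> level u <= (level v).+1
    & exists2 le, tree_order le &
        forall u v, (level u).+1 = highest_level ->
          (level v).+1 = highest_level ->
          le u v -> top_pendant_parent u -> top_pendant_parent v].

End Rooted.

Lemma unit_edge_sym : symmetric (fun _ _ : unit => false). Proof. by []. Qed.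
Lemma unit_edge_irr : irreflexive (fun _ : unit => fun _ : unit => false).
Proof. by []. Qed.

Definition unit_pointed_graph : pointed_graph :=
  @PointedGraph (SGraph unit_edge_sym unit_edge_irr) tt.

(* The rgood binary tree on l vertices, unique up to isomorphism; for odd l it
   exists by [TrgP] below. *)
Definition Trg (l : nat) : pointed_graph :=
  epsilon (inhabits unit_pointed_graph) (fun T => rgood T /\ #|T| = l).

Definition R (l : nat) : nat := num_subtrees (point (Trg l)).

(** * Crg trees *)

Section Identify.
Variables (K H : pointed_graph).

(* The disjoint union of K and H with their points identified: the point of H
   is dropped and its edges are attached to the point of K. *)
Definition identify_vertex : finType := (K + {x : H | x != point H})%type.

Definition identify_edge : rel identify_vertex := fun x y =>
  match x, y with
  | inl a, inl b => edge a b
  | inr a, inr b => edge (val a) (val b)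
  | inl a, inr b => (a == point K) && edge (point H) (val b)
  | inr a, inl b => (b == point K) && edge (point H) (val a)
  end.

Lemma identify_edge_sym : symmetric identify_edge.
Proof. by case=> a [] b //=; apply: edge_sym. Qed.

Lemma identify_edge_irr : irreflexive identify_edge.
Proof. by case=> a /=; apply: edge_irr. Qed.

Definition identify_points : sgraph :=
  SGraph identify_edge_sym identify_edge_irr.

End Identify.

(* A binary caterpillar on k vertices (unique up to isomorphism) with a marked
   vertex of maximum eccentricity; for even k > 0 it exists by
   [caterpillarP] below. *)
Definition caterpillar (k : nat) : pointed_graph :=
  epsilon (inhabits unit_pointed_graph)
    (fun K => [/\ binary_caterpillar K, #|K| = k
                & forall v : K, ecc v <= ecc (point K)]).

Definition Tcrg (n l : nat) : sgraph :=
  identify_points (caterpillar (n - l + 1)) (Trg l).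

(** * Existence of the trees chosen above *)

Section ParentGraph.
Variables (n : nat) (par : nat -> nat).
Hypothesis par_lt : forall i, 0 < i -> par i < i.

Definition par_edge : rel 'I_n.+1 := fun i j =>
  (0 < i) && (par i == j) || (0 < j) && (par j == i).

Lemma par_edge_sym : symmetric par_edge.
Proof. by move=> i j; rewrite /par_edge orbC. Qed.

Lemma par_edge_irr : irreflexive par_edge.
Proof.
move=> i; rewrite /par_edge orbb; apply/negP => /andP[i0 /eqP e].
by move: (par_lt i0); rewrite e ltnn.
Qed.

Definition par_graph := SGraph par_edge_sym par_edge_irr.

Lemma par_edge_gt (x y : 'I_n.+1) : par_edge x y -> y <= x ->
  0 < x /\ par x = y.
Proof.
rewrite /par_edge => /orP[/andP[x0 /eqP //]|/andP[y0 /eqP e]] yx.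
by move: (par_lt y0); rewrite e ltnNge yx.
Qed.

Lemma par_connect0 (i : 'I_n.+1) : connect par_edge ord0 i.
Proof.
case: i => i; elim/ltn_ind: i => -[|i] IH hi.
  by apply: eq_connect0; apply: val_inj.
have pl := par_lt (ltn0Sn i).
have hp : par i.+1 < n.+1 by apply: ltn_trans pl hi.
apply: connect_trans (IH _ pl hp) _; apply: connect1.
by rewrite /par_edge /= eqxx orbT.
Qed.

Lemma par_tree : is_tree par_graph.
Proof.
split=> [|x y|c cc uc]; first by rewrite card_ord.
  apply: connect_trans (par_connect0 y).
  by rewrite (sym_connect_sym par_edge_sym) par_connect0.
rewrite ltnNge; apply/negP => sc.
have [x0 x0c] : exists x0, x0 \in c by case: (c) sc => // a; exists a; rewrite inE eqxx.
case: (@arg_maxnP _ x0 (fun x : 'I_n.+1 => x \in c) (@nat_of_ord _) x0c) => x xc xmax.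
case: (rot_to xc) => i s e.
have: cycle par_edge (x :: s) by rewrite -e rot_cycle.
have: uniq (x :: s) by rewrite -e rot_uniq.
have: size (x :: s) > 2 by rewrite -e size_rot.
have mx z : z \in s -> z <= x.
  by move=> zs; apply: xmax; rewrite -(mem_rot i) e inE zs orbT.
case: s {e} mx => [|y s] //= mx; case/lastP: s mx => [|s z] //= mx _ us.
rewrite rcons_path last_rcons => /andP[exy /andP[_ ezx]].
have [_ e1] := par_edge_gt exy (mx _ (mem_head _ _)).
rewrite par_edge_sym in ezx.
have zs : z \in y :: rcons s z by rewrite inE mem_rcons mem_head orbT.
have [_ e2] := par_edge_gt ezx (mx _ zs).
have eyz : y = z by apply: val_inj; rewrite /= -e1 -e2.
by move: us; rewrite eyz mem_rcons mem_head /= andbF.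
Qed.

Variable dep : nat -> nat.
Hypothesis dep0 : dep 0 = 0.
Hypothesis depS : forall i, 0 < i -> dep i = (dep (par i)).+1.

Lemma dep_le i : dep i <= i.
Proof.
elim/ltn_ind: i => -[|i] IH; first by rewrite dep0.
by rewrite depS //; apply: leq_ltn_trans (IH _ _) _; apply: par_lt.
Qed.

Lemma dep_path (x : 'I_n.+1) p : path par_edge x p -> dep (last x p) <= dep x + size p.
Proof.
elim: p x => [|y p IH] x /=; first by rewrite addn0.
move=> /andP[exy /IH h]; apply: leq_trans h _; rewrite addnS -addSn leq_add2r.
by move: exy => /orP[] /andP[i0 /eqP e]; rewrite (depS i0) e ?leqnn //; lia.
Qed.

Lemma dep_walk (i : par_graph) : walk_of_length (ord0 : par_graph) i (dep i).
Proof.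
suff [p pp lp] : exists2 p, path par_edge ord0 p /\ last ord0 p = i & size p = dep i.
  by apply/existsP; exists (tcast lp (in_tuple p)); rewrite val_tcast pp.1 pp.2 eqxx.
case: i => i; elim/ltn_ind: i => -[|i] IH hi.
  by exists [::]; rewrite /= ?dep0 //; split=> //; apply: val_inj.
have pl := par_lt (ltn0Sn i).
have hp : par i.+1 < n.+1 by apply: ltn_trans pl hi.
have [p [pp lp] sp] := IH _ pl hp.
exists (rcons p (Ordinal hi)); last by rewrite size_rcons sp /= (@depS i.+1).
by rewrite rcons_path last_rcons pp lp /= /par_edge /= eqxx orbT.
Qed.

Lemma par_dist (i : par_graph) : dist (ord0 : par_graph) i = dep i.
Proof.
have di : dep i < #|par_graph| by rewrite card_ord ltnS; apply: leq_trans (dep_le i) _; rewrite -ltnS.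
apply/eqP; rewrite eqn_leq; apply/andP; split.
  exact: (@Order.TotalTheory.bigmin_le_cond _ nat _ _ (Ordinal di)
            (fun k => walk_of_length _ i k) (@nat_of_ord _) (dep_walk i)).
rewrite /dist; apply: (big_ind (fun k => dep i <= k)) => [|x y hx hy|k].
- exact: ltnW.
- by rewrite leq_min hx hy.
- case/existsP => p /andP[pp /eqP lp]; move: (dep_path pp).
  by rewrite lp /= dep0 add0n size_tuple.
Qed.


Lemma par_degree (i : par_graph) (s : seq nat) : uniq s ->
  (forall j, (j \in s) =
     (j < n.+1) && ((0 < (i : 'I_n.+1)) && (par (i : 'I_n.+1) == j)
                    || (0 < j) && (par j == (i : 'I_n.+1)))) ->
  degree i = size s.
Proof.
move=> us sP; have sn j : j \in s -> j < n.+1 by rewrite sP => /andP[].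
rewrite /degree -(size_map (@inord n)).
have uis : uniq (map (@inord n) s).
  by rewrite map_inj_in_uniq // => a b /sn ha /sn hb /(congr1 val); rewrite /= !inordK.
rewrite -(card_uniqP uis); apply: eq_card => j; rewrite inE.
apply/idP/mapP => [h|[a ais ->]].
  by exists (nat_of_ord j); [rewrite sP ltn_ord|rewrite inord_val].
by have := ais; rewrite sP /= /par_edge inordK ?sn // => /andP[].
Qed.

End ParentGraph.

Definition heap_parent (i : nat) := i.-1./2.

Lemma heap_parent_lt i : 0 < i -> heap_parent i < i.
Proof. by rewrite /heap_parent; lia. Qed.

Definition heap_level (i : nat) := trunc_log 2 i.+1.

Lemma heap_level0 : heap_level 0 = 0.
Proof. exact: trunc_log1. Qed.

Lemma heap_levelS i : 0 < i -> heap_level i = (heap_level (heap_parent i)).+1.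
Proof.
move=> i0; rewrite /heap_level trunc_log2S; last lia.
by congr (trunc_log 2 _).+1; rewrite /heap_parent; lia.
Qed.

Lemma heap_level_child i : heap_level i.*2.+1 = (heap_level i).+1.
Proof. by rewrite heap_levelS // /heap_parent /= doubleK. Qed.

Section Heap.
Variable k : nat.

Definition heap := par_graph k.*2 heap_parent_lt.

Definition pointed_heap := @PointedGraph heap ord0.

Let nat_of (i : heap) : nat := nat_of_ord (i : 'I_k.*2.+1).

Lemma heap_leaf_degree (i : heap) : 0 < k -> k <= nat_of i -> degree i = 1.
Proof.
move=> k0 ki; rewrite (@par_degree _ _ _ _ [:: heap_parent (nat_of i)]) // => j.
by rewrite inE /heap_parent; have := ltn_ord (i : 'I_k.*2.+1); rewrite -/(nat_of i); lia.
Qed.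

Lemma heap_root_degree (i : heap) : 0 < k -> nat_of i = 0 -> degree i = 2.
Proof.
move=> k0 i0; rewrite (@par_degree _ _ _ _ [:: 1; 2]) // => j.
by rewrite -/(nat_of i) i0 !inE /heap_parent; lia.
Qed.

Lemma heap_inner_degree (i : heap) : 0 < nat_of i -> nat_of i < k -> degree i = 3.
Proof.
move=> i0 ik; rewrite (@par_degree _ _ _ _
  [:: heap_parent (nat_of i); (nat_of i).*2.+1; (nat_of i).*2.+2]) //.
  by rewrite /= !inE /heap_parent; lia.
by move=> j; rewrite -/(nat_of i) !inE /heap_parent; lia.
Qed.

Lemma heap_pendant (i : heap) : pendant i -> 0 < k /\ k <= nat_of i.
Proof.
have lt := ltn_ord (i : 'I_k.*2.+1); rewrite -/(nat_of i) in lt.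
rewrite /pendant => /eqP d; have [k0|k0] := posnP k.
  by move: d; rewrite (@par_degree _ _ _ _ [::]) // => j; rewrite -/(nat_of i) in_nil /heap_parent; lia.
split=> //; rewrite leqNgt; apply/negP => ik.
have [i0|i0] := posnP (nat_of i).
  by move: d; rewrite heap_root_degree.
by move: d; rewrite heap_inner_degree.
Qed.

Lemma heap_distE (i : heap) : dist (ord0 : heap) i = heap_level (nat_of i).
Proof. exact: (par_dist heap_level0 heap_levelS). Qed.

Lemma heap_parentE (u x : heap) : @parent pointed_heap u x ->
  0 < nat_of x /\ nat_of u = heap_parent (nat_of x).
Proof.
rewrite /parent /level /= !heap_distE => /andP[+ /eqP].
case/orP=> /andP[+ /eqP e]; rewrite -/(nat_of _) ?e; last by [].
by move=> /heap_levelS; rewrite e -/(nat_of _); lia.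
Qed.

Lemma heap_child (v : heap) : nat_of v < k ->
  exists2 y, @parent pointed_heap v y & nat_of y = (nat_of v).*2.+1.
Proof.
move=> vk; have ly : (nat_of v).*2.+1 < k.*2.+1 by lia.
exists (Ordinal ly) => //; rewrite /parent /level /= !heap_distE /nat_of /=.
rewrite heap_level_child eqxx andbT /par_edge /=; apply/orP; right.
by rewrite /heap_parent /= doubleK.
Qed.

Lemma heap_rgood : rgood pointed_heap.
Proof.
split.
- split; first exact: par_tree.
  have [k0|k0] := posnP k; first by left; rewrite card_ord k0.
  right; split=> [|v vr]; first exact: heap_root_degree.
  have v0 : 0 < nat_of v.
    by rewrite lt0n; apply: contraNneq vr => v0; apply/eqP/val_inj.
  by have [vk|kv] := ltnP (nat_of v) k; [right|left];
    [apply: heap_inner_degree|apply: heap_leaf_degree].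
- move=> u v pu /heap_pendant[k0 kv]; rewrite /level /= !heap_distE.
  rewrite -heap_level_child /heap_level; apply: leq_trunc_log.
  by have := ltn_ord (u : 'I_k.*2.+1); rewrite -/(nat_of u); lia.
exists (fun x y : heap => nat_of y <= nat_of x).
  split=> [l _|l u v x y l1 _ _ /heap_parentE[x0 ux] /heap_parentE[y0 vy] uv].
    split=> [x y _ _|x y _ _ yx|y x z _ _ _ yx zy]; first exact: leq_total.
      by apply: val_inj; apply/eqP; rewrite eqn_leq andbC.
    exact: leq_trans zy yx.
  have uv' : nat_of u != nat_of v by apply: contraNneq uv => e; apply/eqP/val_inj.
  by move: uv'; rewrite ux vy /heap_parent; lia.
move=> u v hu hv /= vu /existsP[x /and3P[px /eqP lx /heap_parentE[x0 ux]]].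
have lt := ltn_ord (x : 'I_k.*2.+1); rewrite -/(nat_of x) in lt.
have uk : nat_of u < k by rewrite ux /heap_parent; lia.
have [y vy ey] := heap_child (leq_ltn_trans vu uk).
have ly : level y = @highest_level pointed_heap by rewrite -hv; case/andP: vy => _ /eqP.
apply/existsP; exists y; rewrite ly eqxx vy !andbT.
rewrite /pendant heap_leaf_degree //; first lia.
rewrite leqNgt; apply/negP => /heap_child[z /andP[_ /eqP lz] _].
have : level z <= @highest_level pointed_heap by apply: (@leq_bigmax _ (@level pointed_heap)).
by rewrite lz ly ltnn.
Qed.

End Heap.

Lemma TrgP (l : nat) : odd l -> rgood (Trg l) /\ #|Trg l| = l.
Proof.
move=> ol; apply: (epsilon_spec (inhabits unit_pointed_graph)
  (fun T : pointed_graph => rgood T /\ #|T| = l)).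
exists (pointed_heap l./2); split; first exact: heap_rgood.
by rewrite card_ord -[RHS](odd_double_half l) ol.
Qed.

(* The spine consists of the odd vertices; vertex 0 and the last vertex are
   its two end leaves. *)
Definition spine_parent (i : nat) := if odd i then i - 2 else i.-1.

Lemma spine_parent_lt i : 0 < i -> spine_parent i < i.
Proof. by rewrite /spine_parent; case: ifP => _; lia. Qed.

Section Spine.
Variable k : nat.

Definition spine := par_graph k.*2.+1 spine_parent_lt.

Let nat_of (i : spine) : nat := nat_of_ord (i : 'I_k.*2.+2).

Lemma spine_degree (i : spine) : ~~ pendant i -> degree i = 3.
Proof.
have lt := ltn_ord (i : 'I_k.*2.+2); rewrite -/(nat_of i) in lt.
have leaf (p : nat) : (forall j, (j \in [:: p]) =
     (j < k.*2.+2) && ((0 < nat_of i) && (spine_parent (nat_of i) == j)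
                    || (0 < j) && (spine_parent j == nat_of i))) -> pendant i.
  by move=> h; rewrite /pendant (@par_degree _ _ _ _ [:: p]).
case e : (odd (nat_of i)) => np; last first.
  case/negP: np; apply: (leaf (if nat_of i == 0 then 1 else (nat_of i).-1)) => j.
  rewrite inE /spine_parent e.
  by case oj: (odd j); case: (eqVneq (nat_of i) 0) => [i0|i0]; lia.
have [last_i|not_last] := eqVneq (nat_of i) k.*2.+1.
  case/negP: np; apply: (leaf (if k == 0 then 0 else (nat_of i) - 2)) => j.
  rewrite inE /spine_parent e.
  by case oj: (odd j); case: (eqVneq k 0) => [k0|k0]; lia.
rewrite (@par_degree _ _ _ _ [:: if nat_of i == 1 then 0 else nat_of i - 2;
   (nat_of i).+1; (nat_of i).+2]) //; first by rewrite /= !inE; case: (eqVneq (nat_of i) 1) => [i1|i1]; lia.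
move=> j; rewrite -/(nat_of i) !inE /spine_parent e.
by case oj: (odd j); case: (eqVneq (nat_of i) 1) => [i1|i1]; lia.
Qed.

Lemma spine_caterpillar : binary_caterpillar spine.
Proof.
split; first by split; [exact: par_tree | exact: spine_degree].
pose o j : 'I_k.*2.+2 := inord j.*2.+1.
have oE j : j <= k -> o j = j.*2.+1 :> nat by move=> jk; rewrite /o inordK //; lia.
exists (o 0 : spine), [seq o j | j <- iota 1 k]; split.
- have: forall m j, j + m <= k -> path (@edge spine) (o j) [seq o i | i <- iota j.+1 m].
    elim=> [//|m IH] j jm; rewrite /= {}IH ?andbT; last lia.
    rewrite /edge /= /par_edge !oE; [|lia|lia].
  have -> : spine_parent j.+1.*2.+1 = j.*2.+1 by rewrite /spine_parent /= odd_double /=; lia.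
  by rewrite eqxx orbT.
  exact.
- rewrite -[o 0 :: _]/(map o (iota 0 k.+1)) map_inj_in_uniq ?iota_uniq // => a b.
  by rewrite !mem_iota => ha hb /(congr1 (@nat_of_ord _)); rewrite !oE //; lia.
rewrite -[o 0 :: _]/(map o (iota 0 k.+1)) => v vs.
have lt := ltn_ord (v : 'I_k.*2.+2); rewrite -/(nat_of v) in lt.
have ev : ~~ odd (nat_of v).
  apply: contra vs => ov; apply/mapP; exists (nat_of v)./2; first by rewrite mem_iota; lia.
  by apply: val_inj; rewrite /= oE -/(nat_of v); lia.
exists (o ((nat_of v).-1)./2); first by apply: map_f; rewrite mem_iota; lia.
rewrite /edge /= /par_edge oE -/(nat_of v); last lia.
rewrite /spine_parent (negbTE ev) /= odd_double /=.
by case: (eqVneq (nat_of v) 0) => [->|v0]; lia.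
Qed.

End Spine.

Lemma caterpillarP (k : nat) : ~~ odd k -> 0 < k ->
  [/\ binary_caterpillar (caterpillar k), #|caterpillar k| = k
    & forall v : caterpillar k, ecc v <= ecc (point (caterpillar k))].
Proof.
move=> ek k0; apply: (epsilon_spec (inhabits unit_pointed_graph)
  (fun K : pointed_graph => [/\ binary_caterpillar K, #|K| = k
                              & forall v : K, ecc v <= ecc (point K)])).
pose G := spine (k./2).-1.
case: (@arg_maxnP G ord0 predT (@ecc G) isT) => x _ xmax.
exists (@PointedGraph G x); split; [exact: spine_caterpillar| |by move=> v; exact: xmax].
by rewrite /= card_ord; lia.
Qed.

(* Main.v *)
Require Import Defs.
From mathcomp Require Import all_boot.
From mathcomp Require Import all_order zify.

(* Let v_0 be the root of the rgood part, v_1, ..., v_{j+1} the path of the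
   caterpillar attached to it, j = (n-l-1)/2, and h the height of the rgood
   part. Deleting the edge v_i v_{i+1} leaves two trees; if a_i and g_{i+1} count
   the subtrees in them through v_i and v_{i+1}, then v_i lies in strictly more
   subtrees than v_{i+1} iff a_i > g_{i+1}, and a_i + 2 = 2^i (R_l + 2),
   g_{i+1} + 2 = 3 * 2^(j-i). So R_l > 3 * 2^j - 2 says exactly that the core lies
   in the rgood part, in fact at v_0 or at one of its two children, whereas the
   center is at v_i with i about (j+1-h)/2. Below the threshold l, lowering the
   size of the rgood part by 2t moves the core by at least t along the path
   (since R_{l+2} + 2 >= 2 (R_l + 2)), and the center by at most t. Above the
   threshold, the center moves towards the root and the core can move by at most
   one, which compensates only in the cases (n, l) = (12, 7) and (16, 9) that are
   settled by hand. *)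

Set Implicit Arguments.
Unset Strict Implicit.
Unset Printing Implicit Defensive.

(** * Sides of an edge and distances in trees *)

(** The trees are chosen by [epsilon], so only their defining properties are available. Both halves
    are therefore first reduced to an inductive shape [btree] through [hang]: rgoodness yields
    [rgshape], while the dominating path and the maximal eccentricity of the marked vertex yield a
    comb. All counts and heights are then computed on shapes.

    The two formulas come from one recursion: a new root carrying a leaf and a tree with r root
    subtrees has 2 (r + 1) root subtrees, so r + 2 doubles; the factor 3 is r + 2 for a single
    vertex.

    The maximal distance is never computed exactly. With h = k + 1, the threshold tree is only shown
    to reach (j - k)/2, rounded down. Every other tree gets an upper bound: its own (j - k)/2 minus
    the displacement of the core below the threshold, and plus at most one above it. Sizes are
    written n = 2N, l = 2a + 1, m = 2q + 1, and k is the integer part of the binary logarithm of a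
    or of q. *)

Lemma connect_invariant (T : finType) (e : rel T) (P : pred T) x y :
  (forall a b, e a b -> P a -> P b) -> connect e x y -> P x -> P y.
Proof.
move=> eP /connectP[p + ->]; elim: p x => //= a p IH x /andP[xa ap] Px.
exact: IH ap (eP _ _ xa Px).
Qed.

Section Sides.
Variable G : sgraph.
Implicit Types (u v w x y z : G) (X : {set G}).

Definition del_edge u v : rel G := fun x y =>
  edge x y && ~~ ((x == u) && (y == v) || (x == v) && (y == u)).

Definition side u v : {set G} := [set x | connect (del_edge u v) u x].

(** Acyclicity in the form that every edge is a bridge. It concerns connectivity only, so it passes
    to glued trees by an invariant along a walk, without handling cycles. *)
Definition treelike : Prop :=
  (forall x y, connect (@edge G) x y) /\
  (forall u v, edge u v -> v \notin side u v).

Lemma is_tree_treelike : is_tree G -> treelike.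
Proof.
case=> _ cG acyc; split=> // u v uv; rewrite inE; apply/negP => /connectP[p pp].
case/shortenP: pp => p' pp up _ e.
have cyc : cycle (@edge G) (u :: p').
  rewrite /= rcons_path -e edge_sym uv andbT.
  by apply: sub_path pp => x y /andP[].
have := acyc _ cyc up; case: p' pp up e {cyc} => [|y [|z p']] //=.
  by move=> _ _ e; rewrite e edge_irr in uv.
by rewrite /del_edge => /andP[+ _] _ e _; rewrite e !eqxx andbF.
Qed.

Lemma edge_neq u v : edge u v -> u != v.
Proof. by apply: contraTneq => ->; rewrite edge_irr. Qed.

Lemma side_refl u v : u \in side u v.
Proof. by rewrite inE connect0. Qed.

Lemma del_edge_sym u v : symmetric (del_edge u v).
Proof.
move=> x y; rewrite /del_edge edge_sym; congr (_ && ~~ _).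
by rewrite orbC andbC [X in _ || X]andbC.
Qed.

Lemma del_edgeC u v : del_edge u v =2 del_edge v u.
Proof. by move=> x y; rewrite /del_edge orbC. Qed.

Lemma side_closed u v x y : x \in side u v -> del_edge u v x y -> y \in side u v.
Proof. by rewrite !inE => ux xy; apply: connect_trans ux (connect1 xy). Qed.

Lemma side_cross u v x y : edge x y -> x \in side u v -> y \notin side u v ->
  x = u /\ y = v.
Proof.
move=> xy xs ys; have: ~~ del_edge u v x y.
  by apply: contra ys; apply: side_closed.
rewrite /del_edge xy /= negbK => /orP[/andP[/eqP-> /eqP->] //|/andP[_ /eqP yu]].
by rewrite yu side_refl in ys.
Qed.

Lemma side_subset u v x (Y : {set G}) :
  (forall a b, edge a b -> a \in side u v -> b \in side u v -> a \in Y -> b \in Y) ->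
  u \in Y -> x \in side u v -> x \in Y.
Proof.
move=> cl uY xs.
have cx : connect (del_edge u v) u x by rewrite inE in xs.
suff /andP[] : [pred a in side u v | a \in Y] x by [].
apply: connect_invariant cx _ => /= [a b ab /andP[sa Ya]|]; last by rewrite side_refl uY.
have sb := side_closed sa ab; rewrite sb (cl a b) //.
by case/andP: ab.
Qed.

Hypothesis tG : treelike.

Lemma notin_side u v : edge u v -> v \notin side u v.
Proof. by case: tG => _; apply. Qed.

Lemma side_compl u v : edge u v -> side v u = ~: side u v.
Proof.
move=> uv; have vu : edge v u by rewrite edge_sym.
apply/setP => x; rewrite in_setC; apply/idP/idP => [xv|xu].
  apply/negP => xu; have := notin_side vu; rewrite inE.
  move: xv xu; rewrite !inE => xv; rewrite (sym_connect_sym (del_edge_sym u v)).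
  by rewrite (eq_connect (del_edgeC u v)) => /(connect_trans xv) ->.
have cx : connect (@edge G) u x by case: tG.
suff /orP[|//] : [pred a | (a \in side u v) || (a \in side v u)] x by rewrite (negbTE xu).
apply: connect_invariant cx _ => /= [a b ab /orP[as_|as_]|]; last by rewrite side_refl.
  have [//|bs] := boolP (b \in side u v).
  by have [_ ->] := side_cross ab as_ bs; rewrite side_refl.
have [|bs] := boolP (b \in side v u); first by rewrite orbT.
by have [_ ->] := side_cross ab as_ bs; rewrite side_refl.
Qed.

Lemma mem_side u v x : edge u v -> (x \in side v u) = (x \notin side u v).
Proof. by move/side_compl->; rewrite in_setC. Qed.

(** A walk can leave [side x z] only from [x], and [x] does not belong to [side y x]. *)
Lemma side_mono x y z : edge x y -> edge x z -> y != z -> side y x \subset side x z.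
Proof.
move=> xy xz yz; apply/subsetP => a; apply: side_subset.
  move=> b c bc bs cs bY; apply/negPn/negP => cY.
  have [bx _] := side_cross bc bY cY.
  by move: bs; rewrite bx; apply/negP; apply: notin_side; rewrite edge_sym.
apply: side_closed (side_refl _ _) _.
by rewrite /del_edge xy /= eqxx (negbTE yz) [x == z]eq_sym eq_sym (negbTE (edge_neq xz)).
Qed.

(* The vertices reachable from u without entering the neighbours in X. *)
Definition branch X u : {set G} := [set x | [forall v in X, x \in side u v]].

Lemma branch0 u : branch set0 u = [set: G].
Proof. by apply/setP => x; rewrite !inE; apply/forall_inP => v; rewrite inE. Qed.

Lemma branch1 u v : branch [set v] u = side u v.
Proof.
apply/setP => x; rewrite [LHS]inE; apply/forall_inP/idP => [|h w /set1P-> //].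
by apply; rewrite set11.
Qed.

Definition nbrs u : {set G} := [set w | edge u w].

Lemma side_nbr u x : x != u -> exists2 w, w \in nbrs u & x \in side w u.
Proof.
move=> xu; have cx : connect (@edge G) u x by case: tG.
suff : [pred a | (a == u) || [exists w in nbrs u, a \in side w u]] x.
  by rewrite /= (negbTE xu) => /exists_inP[w]; exists w.
apply: connect_invariant cx _ => /=; last by rewrite eqxx.
move=> a b ab /= /orP[/eqP au|/exists_inP[w wu aw]].
  apply/orP; right; apply/exists_inP; exists b; rewrite ?side_refl //.
  by rewrite inE -au.
have [bw|bw] := boolP (b \in side w u).
  by apply/orP; right; apply/exists_inP; exists w.
by have [_ ->] := side_cross ab aw bw; rewrite eqxx.
Qed.

Lemma branchP X u x : X \subset nbrs u ->
  reflect (x = u \/ exists2 w, w \in nbrs u :\: X & x \in side w u)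
          (x \in branch X u).
Proof.
move=> sX; rewrite inE; apply: (iffP forall_inP) => [h|].
  have [->|/side_nbr[w wu xw]] := eqVneq x u; [by left|right; exists w => //].
  rewrite inE wu andbT; apply/negP => /h; apply/negP.
  by rewrite -mem_side //; rewrite inE in wu.
case=> [-> v _|[w /setDP[wu wX] xw] v vX]; first exact: side_refl.
have uw : edge u w by rewrite inE in wu.
have uv : edge u v by have := subsetP sX _ vX; rewrite inE.
by apply: (subsetP (side_mono uw uv _)) xw; apply: contraNneq wX => ->.
Qed.

Lemma side_disjoint u w w' x : edge u w -> edge u w' -> w != w' ->
  x \in side w u -> x \notin side w' u.
Proof.
move=> uw uw' ww' xw; rewrite (mem_side _ uw') negbK.
exact: (subsetP (side_mono uw uw' ww')).
Qed.

End Sides.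

Section Distance.
Variable G : sgraph.
Implicit Types (u v w x y z : G).


Lemma dist_le_card x y : dist x y <= #|G|.
Proof.
rewrite /dist; apply: (big_ind (fun k => k <= #|G|)) => // [a b|i _].
  by rewrite geq_min => ->.
exact: ltnW.
Qed.

Lemma dist_path x p : path (@edge G) x p -> dist x (last x p) <= size p.
Proof.
move=> pp; have [le|lt] := leqP #|G| (size p).
  by apply: leq_trans le; apply: dist_le_card.
apply: (@Order.TotalTheory.bigmin_le_cond _ nat _ _ (Ordinal lt)
            (fun k => walk_of_length _ _ k) (@nat_of_ord _)).
by apply/existsP; exists (in_tuple p); rewrite pp eqxx.
Qed.

Lemma distxx x : dist x x = 0.
Proof. by apply/eqP; rewrite -leqn0; apply: (@dist_path x [::]). Qed.

Hypothesis tG : treelike G.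

Lemma dist_attained x y :
  exists p, [/\ path (@edge G) x p, last x p = y & size p = dist x y].
Proof.
have /connectP[p pp ey] : connect (@edge G) x y by case: tG.
case/shortenP: pp ey => q pq uq _ ey.
have sq : size q < #|G|.
  by have := max_card [in x :: q]; rewrite (card_uniqP uq).
have [/existsP[r /andP[pr /eqP lr]]|no] :=
    boolP [exists r : (dist x y).-tuple G, path (@edge G) x r && (last x r == y)].
  by exists r; rewrite size_tuple.
suff: size q < dist x y by rewrite ltnNge ey dist_path.
rewrite /dist in no *.
(* A filtered minimum is either the default [#|G|] or satisfies the filter; the default is excluded
   because the shortened path [q] has fewer than [#|G|] edges. *)
have: (\big[minn/#|G|]_(k < #|G| | walk_of_length x y k) (k : nat) == #|G|) ||
   walk_of_length x y (\big[minn/#|G|]_(k < #|G| | walk_of_length x y k) (k : nat)).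
  apply: (big_ind (fun k => (k == #|G|) || walk_of_length x y k)); rewrite ?eqxx //.
    by move=> a b; rewrite /minn; case: ifP.
  by move=> i ->; rewrite orbT.
by case/orP => [/eqP->|w] //; rewrite -/(walk_of_length _ _ _) w in no.
Qed.

Lemma dist0_eq x y : dist x y = 0 -> x = y.
Proof. by have [[|? ?] [_ <- <-]] := dist_attained x y. Qed.

Lemma dist_sym x y : dist x y = dist y x.
Proof.
wlog: x y / dist x y < dist y x.
  by move=> h; case: (ltngtP (dist x y) (dist y x)) => // /h.
have [p [pp e <-]] := dist_attained x y.
suff: dist y x <= size p by lia.
have: path (@edge G) y (rev (belast x p)).
  by rewrite -e rev_path; apply: sub_path pp => a b; rewrite edge_sym.
move/dist_path; rewrite size_rev size_belast.
suff -> : last y (rev (belast x p)) = x by [].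
by case: p e {pp} => //= a p _; rewrite rev_cons last_rcons.
Qed.

Lemma dist_triangle y x z : dist x z <= dist x y + dist y z.
Proof.
have [p [pp ep <-]] := dist_attained x y.
have [q [pq eq <-]] := dist_attained y z.
have := @dist_path x (p ++ q); rewrite cat_path pp last_cat ep eq pq size_cat.
exact.
Qed.

Lemma dist_edge x y : edge x y -> dist x y <= 1.
Proof. by move=> xy; apply: (@dist_path x [:: y]); rewrite /= xy. Qed.

Lemma path_cross u v x p : edge u v -> x \in side u v -> last x p \notin side u v ->
  path (@edge G) x p ->
  exists p1 p2, [/\ p = p1 ++ v :: p2, last x p1 = u, path (@edge G) x p1
                  & path (@edge G) v p2].
Proof.
move=> uv; elim: p x => [|y p IH] x /= xs; first by rewrite xs.
move=> ls /andP[xy pp]; have [ys|ys] := boolP (y \in side u v).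
  have [p1 [p2 [-> e P1 P2]]] := IH y ys ls pp.
  by exists (y :: p1), p2; split=> //=; rewrite xy.
have [-> yv] := side_cross xy xs ys.
by exists [::], p; split; rewrite -?yv.
Qed.

Lemma dist_cross u v x y : edge u v -> x \in side u v -> y \in side v u ->
  dist x y = dist x u + 1 + dist v y.
Proof.
move=> uv xs ys; apply/eqP; rewrite eqn_leq; apply/andP; split.
  apply: leq_trans (dist_triangle v _ _) _; rewrite leq_add2r.
  apply: leq_trans (dist_triangle u _ _) _; rewrite leq_add2l.
  exact: dist_edge.
have [p [pp e <-]] := dist_attained x y; subst y.
rewrite (mem_side tG _ uv) in ys.
have [p1 [p2 [-> e1 P1 P2]]] := path_cross uv xs ys pp.
have h1 := dist_path P1; have h2 := dist_path P2.
rewrite last_cat /= size_cat /=; rewrite e1 in h1; lia.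
Qed.

Lemma dist_side u v x : edge u v -> x \in side u v -> dist x v = (dist x u).+1.
Proof.
by move=> uv xs; rewrite (dist_cross uv xs (side_refl _ _)) distxx addn0 addn1.
Qed.

Lemma leq_ecc x v : dist x v <= ecc v.
Proof. exact: (leq_bigmax x). Qed.

Lemma ecc_ge x y v : dist x y <= (ecc v).*2.
Proof.
apply: leq_trans (dist_triangle v _ _) _; rewrite -addnn.
by rewrite leq_add ?leq_ecc // dist_sym leq_ecc.
Qed.

(** Every eccentricity is at least half of every distance, so a vertex whose eccentricity is at most
    half of some distance, rounded up, is central. *)
Lemma mem_center x y v : (ecc v).*2 <= (dist x y).+1 -> v \in center G.
Proof.
by move=> h; rewrite inE; apply/forallP => u; have := ecc_ge x y u; lia.
Qed.

End Distance.

(** * Counting the subtrees through a vertex *)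

Lemma disjoint_set1r (T : finType) (x : T) (A : {set T}) :
  [disjoint A & [set x]] = (x \notin A).
Proof. by rewrite disjoint_sym disjoints1. Qed.

Lemma disjoint_setU1r (T : finType) (x : T) (A B : {set T}) :
  [disjoint A & x |: B] = (x \notin A) && [disjoint A & B].
Proof. by rewrite -!setI_eq0 setIUr setU_eq0 !setI_eq0 disjoint_set1r. Qed.

Section Counting.
Variable G : sgraph.
Implicit Types (u v w x y z : G) (S X : {set G}).

Definition induced S : rel G := fun x y => [&& edge x y, x \in S & y \in S].

Definition connected_from u S := (u \in S) && [forall x in S, connect (induced S) u x].

Definition subtrees_avoiding X u : {set {set G}} :=
  [set S | connected_from u S && [disjoint S & X]].

Definition cnt X u := #|subtrees_avoiding X u|.

Lemma induced_sym S : symmetric (induced S).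
Proof. by move=> x y; rewrite /induced edge_sym [in LHS](andbC (x \in S)). Qed.

Lemma induced_mono S S' : S \subset S' -> subrel (induced S) (connect (induced S')).
Proof.
move=> /subsetP sS x y /and3P[xy xS yS]; apply: connect1.
by rewrite /induced xy !sS.
Qed.

Lemma connected_from1 u : connected_from u [set u].
Proof.
rewrite /connected_from set11; apply/forall_inP => x /set1P->; exact: connect0.
Qed.

Lemma connected_from_reroot u w S : connected_from u S -> w \in S -> connected_from w S.
Proof.
move=> /andP[_ /forall_inP cS] wS; rewrite /connected_from wS; apply/forall_inP => x xS.
apply: connect_trans (cS _ xS).
by rewrite (sym_connect_sym (@induced_sym S)) cS.
Qed.

Lemma connected_from_cap u w S : edge u w -> connected_from u S ->
  connected_from u (S :&: side u w).
Proof.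
move=> uw /andP[uS /forall_inP cS]; rewrite /connected_from inE uS side_refl.
apply/forall_inP => x /setIP[xS xs].
(* A connection may leave the side and come back. The invariant is therefore claimed only at
   vertices of the side, and a return can only happen at [u]. *)
pose P a := (a \in side u w) ==> connect (induced (S :&: side u w)) u a.
suff /implyP : P x by exact.
apply: (connect_invariant (P := P)) (cS x xS) _; last by rewrite /P connect0 implybT.
move=> a b /and3P[ab aS bS] /implyP ca.
apply/implyP => bs; have [as_|as_] := boolP (a \in side u w).
  apply: connect_trans (ca as_) (connect1 _).
  by rewrite /induced ab !inE aS bS /=; rewrite !inE in as_ bs; rewrite as_ bs.
rewrite edge_sym in ab.
by have [-> _] := side_cross ab bs as_; exact: connect0.
Qed.

Lemma connected_from_side u w S : connected_from u S -> edge u w -> w \notin S ->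
  S \subset side u w.
Proof.
move=> /andP[uS /forall_inP cS] uw wS; apply/subsetP => x xS.
apply: (connect_invariant (P := [in side u w])) (cS x xS) (side_refl _ _).
move=> a b /and3P[ab _ bS] as_ /=; apply/negPn/negP => bs.
by have [_ bw] := side_cross ab as_ bs; rewrite -bw bS in wS.
Qed.

Lemma connected_from_union u w S S' : edge u w ->
  connected_from u S -> connected_from w S' -> connected_from u (S :|: S').
Proof.
move=> uw /andP[uS /forall_inP cS] /andP[wS /forall_inP cS'].
rewrite /connected_from inE uS; apply/forall_inP => x /setUP[xS|xS].
  exact: connect_sub (induced_mono (subsetUl _ _)) _ _ (cS _ xS).
apply: connect_trans (connect_sub (induced_mono (subsetUr _ _)) (cS' _ xS)).
by apply: connect1; rewrite /induced uw !inE uS wS orbT.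
Qed.

Lemma cnt_gt0 X u : X \subset nbrs u -> 0 < cnt X u.
Proof.
move=> sX; apply/card_gt0P; exists [set u]; rewrite inE connected_from1 disjoints1.
by apply/negP => /(subsetP sX); rewrite inE edge_irr.
Qed.

Lemma edge_set2 (a b c d : G) : edge c d -> [set c; d] = [set a; b] ->
  a = c /\ b = d \/ a = d /\ b = c.
Proof.
move=> cd e; have: c \in [set a; b] by rewrite -e set21.
have: d \in [set a; b] by rewrite -e set22.
by move=> /set2P[] ed /set2P[] ec; subst c d; rewrite ?edge_irr // in cd; [right|left].
Qed.

Hypothesis tG : treelike G.

(** A subtree is determined by its vertices: if it contained both ends of an edge but not the edge,
    its own connection between them would bypass a bridge. *)
Lemma num_subtreesE u : num_subtrees u = cnt set0 u.
Proof.
pose induced_edges S := [set A : {set G} |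
  [exists x in S, exists y in S, edge x y && (A == [set x; y])]].
have eqE P : subtree P -> P.2 = induced_edges P.1.
  case/and3P=> _ /forall_inP sg /forall_inP cn; apply/setP => A; rewrite inE.
  apply/idP/idP => [/sg //|/exists_inP[x xS /exists_inP[y yS /andP[xy /eqP->]]]].
  apply/negPn/negP => no; have /forall_inP/(_ y yS) cxy := cn x xS.
  have := notin_side tG xy; rewrite inE => /negP; apply.
  apply: connect_sub cxy => a b ab; apply: connect1.
  have [c _ /exists_inP[d _ /andP[cd /eqP e]]] := exists_inP (sg _ ab).
  have eab : edge a b.
    by case: (edge_set2 cd (esym e)) => -[-> ->] //; rewrite edge_sym.
  rewrite /del_edge eab /=; apply: contra no; case/orP=> /andP[/eqP<- /eqP<-] //.
  by rewrite setUC.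
have injP : {in [set P | subtree P & u \in P.1] &, injective (@fst {set G} {set {set G}})}.
  move=> [S E] [S' E'] /= /setIdP[/eqE /= -> _] /setIdP[/eqE /= -> _] -> //.
rewrite /num_subtrees -(card_in_imset injP) /cnt; apply: eq_card => S.
rewrite [RHS]inE; apply/imsetP/andP => [[P]|[cS _]].
  rewrite inE => /andP[stP uP] ->; split; last by rewrite -setI_eq0 setI0 eqxx.
  case/and3P: (stP) => _ /forall_inP sg /forall_inP cn.
  rewrite /connected_from uP; apply/forall_inP => x xP.
  have /forall_inP/(_ x xP) := cn u uP.
  apply: connect_sub => a b; rewrite /subgraph_edge (eqE _ stP) inE.
  case/exists_inP=> c cP /exists_inP[d dP /andP[cd /eqP e]]; apply: connect1.
  rewrite /induced; case: (edge_set2 cd (esym e)) => -[-> ->]; first by rewrite cd cP.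
  by rewrite edge_sym cd dP.
exists (S, induced_edges S) => //.
have uS : u \in S by case/andP: cS.
rewrite inE /= uS andbT; apply/and3P; split=> /=.
- by apply/set0Pn; exists u.
- by apply/forall_inP => A /=; rewrite inE.
apply/forall_inP => x xS; apply/forall_inP => y yS.
have /andP[_ /forall_inP/(_ y yS)] := connected_from_reroot cS xS.
apply: connect_sub => a b /and3P[ab aS bS]; apply: connect1.
rewrite /subgraph_edge inE /=; apply/exists_inP; exists a => //.
by apply/exists_inP; exists b => //; rewrite ab eqxx.
Qed.

(* A subtree through u and w is a subtree through u avoiding w glued to one
   through w avoiding u along the edge uw. *)
Lemma cnt_split X u w : X \subset nbrs u -> w \in nbrs u :\: X ->
  cnt X u = cnt (w |: X) u * (cnt [set u] w).+1.
Proof.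
move=> sX /setDP[]; rewrite inE => uw wX.
have wu : edge w u by rewrite edge_sym.
pose A := [set S : {set G} | w \in S].
rewrite mulnS {1}/cnt -(cardsID A) addnC; congr (_ + _).
  by apply: eq_card => S; rewrite !inE disjoint_setU1r andbCA.
rewrite /cnt -cardsX.
pose f (P : {set G} * {set G}) := P.1 :|: P.2.
(* Gluing is injective: the two parts are recovered by intersecting their union with the two sides
   of the edge. *)
have cap S S' : connected_from u S -> [disjoint S & w |: X] ->
    connected_from w S' -> [disjoint S' & [set u]] ->
    (S :|: S') :&: side u w = S /\ (S :|: S') :&: side w u = S'.
  move=> cS; rewrite disjoint_setU1r disjoint_set1r => /andP[wS _] cS' uS'.
  have s1 := connected_from_side cS uw wS; have s2 := connected_from_side cS' wu uS'.
  rewrite !setIUl (setIidPl s1) (setIidPl s2).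
  rewrite (side_compl tG uw) in s2 *.
  have -> : S' :&: side u w = set0 by apply/eqP; rewrite setI_eq0 disjoints_subset.
  have -> : S :&: ~: side u w = set0.
    by apply/eqP; rewrite setI_eq0 disjoints_subset setCK.
  by rewrite setU0 set0U.
rewrite -(card_in_imset (f := f)); last first.
  move=> [S1 S1'] [S2 S2']; rewrite !inE /= => /andP[/andP[a b] /andP[c d]].
  case/andP=> /andP[a' b'] /andP[c' d']; rewrite /f /= => e.
  have [e1 e2] := cap _ _ a b c d; have [e3 e4] := cap _ _ a' b' c' d'.
  by move: e1 e2; rewrite e e3 e4 => -> ->.
apply: eq_card => S; rewrite inE; apply/andP/imsetP => [|[[S1 S2]]].
  rewrite !inE => -[/andP[cS dS] wS]; exists (S :&: side u w, S :&: side w u).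
    rewrite !inE /= connected_from_cap //= connected_from_cap //; last first.
      exact: connected_from_reroot cS wS.
    rewrite disjoint_setU1r disjoint_set1r in_setI (negbTE (notin_side tG uw)) andbF /=.
    rewrite (disjointWl (subsetIl _ _) dS) /=.
    by rewrite in_setI (negbTE (notin_side tG wu)) andbF.
  by rewrite /f /= (side_compl tG uw) -setIUr setUCr setIT.
rewrite !inE /= => /andP[/andP[c1 d1] /andP[c2 d2]] ->; rewrite /f /=.
rewrite (connected_from_union uw) //=; split; last first.
  by case/andP: c2 => wS2 _; rewrite inE wS2 orbT.
have uS2 : u \notin S2 by rewrite -disjoint_set1r.
have s2 := connected_from_side c2 wu uS2.
rewrite disjoints_subset subUset -!disjoints_subset.
move: (d1); rewrite disjoint_setU1r => /andP[_ ->] /=.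
rewrite disjoints_subset; apply: subset_trans s2 _.
apply/subsetP => x xs; rewrite inE; apply/negP => xX.
have ux : edge u x by have := subsetP sX _ xX; rewrite inE.
have xw : x != w by apply: contraNneq wX => <-.
by have := side_disjoint tG ux uw xw (side_refl _ _); rewrite xs.
Qed.

Lemma cnt_nbrs u : cnt (nbrs u) u = 1.
Proof.
apply: (@eq_card1 _ [set u]) => S; rewrite !inE; apply/idP/eqP => [|->]; last first.
  by rewrite connected_from1 disjoints1 inE edge_irr.
case/andP=> /andP[uS /forall_inP cS] dS; apply/eqP; rewrite eqEsubset sub1set uS andbT.
apply/subsetP => x xS; apply: (connect_invariant (P := [in [set u]])) (cS x xS) (set11 _).
move=> a b /and3P[ab _ bS] /set1P au; rewrite au in ab.
by have := disjointFr dS bS; rewrite [b \in nbrs u]inE ab.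
Qed.

Lemma num_subtrees_edge u v : edge u v ->
  num_subtrees u = cnt [set v] u * (cnt [set u] v).+1.
Proof.
move=> uv; rewrite num_subtreesE (@cnt_split _ _ v) ?sub0set ?setU0 //.
by rewrite !inE.
Qed.

(** The two numbers are A (B + 1) and B (A + 1), and the common term AB cancels. *)
Lemma leq_num_subtrees u v : edge u v ->
  (num_subtrees u <= num_subtrees v) = (cnt [set v] u <= cnt [set u] v).
Proof.
move=> uv; rewrite (num_subtrees_edge uv) (@num_subtrees_edge v u) 1?edge_sym //.
by rewrite !mulnS [X in _ + X <= _]mulnC leq_add2r.
Qed.

Lemma cnt_lt x y z : edge x y -> edge x z -> z != y -> cnt [set x] z < cnt [set y] x.
Proof.
move=> xy xz zy; rewrite (@cnt_split [set y] x z); first last.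
- by rewrite !inE zy.
- by rewrite sub1set inE.
rewrite -[X in X < _]mul1n -[X in X <= _]mul1n leq_mul //; last by rewrite mul1n.
by apply: cnt_gt0; rewrite subUset !sub1set !inE xz.
Qed.

(** Unimodality along paths: with each further step away from [y] the count ahead decreases and the
    count behind increases, by [cnt_lt], so the inequality at the first edge persists. *)
Lemma num_subtrees_side y x z : edge y x -> cnt [set y] x <= cnt [set x] y ->
  z \in side x y -> num_subtrees z <= num_subtrees y.
Proof.
have [n] := ubnP #|side x y|; elim: n x y => // n IH x y.
rewrite ltnS => sz yx le zs; have xy : edge x y by rewrite edge_sym.
have := le; rewrite -leq_num_subtrees // => xley.
rewrite -(branch1 x y) in zs; case/branchP: zs => //; first by rewrite sub1set inE.
  by move=> ->.
case=> w; rewrite in_setD1 in_set => /andP[wy xw] zw; apply: leq_trans xley.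
apply: (IH w) => //.
  apply: leq_trans sz; apply: proper_card; rewrite properE side_mono //.
  apply/subsetPn; exists x; rewrite ?side_refl //.
  by apply: notin_side; rewrite // edge_sym.
apply: ltnW; apply: leq_trans (cnt_lt xy xw wy) _; apply: leq_trans le _.
by apply: ltnW; apply: cnt_lt => //; rewrite eq_sym.
Qed.

Lemma num_subtrees_side_lt y x z : edge y x -> cnt [set y] x < cnt [set x] y ->
  z \in side x y -> num_subtrees z < num_subtrees y.
Proof.
move=> yx lt zs; have xy : edge x y by rewrite edge_sym.
have xlty : num_subtrees x < num_subtrees y by rewrite ltnNge leq_num_subtrees // -ltnNge.
rewrite -(branch1 x y) in zs; case/branchP: zs => //; first by rewrite sub1set inE.
  by move=> ->.
case=> w; rewrite in_setD1 in_set => /andP[wy xw] zw; apply: leq_ltn_trans xlty.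
apply: num_subtrees_side zw => //.
apply: ltnW; apply: leq_trans (cnt_lt xy xw wy) _; apply: leq_trans (ltnW lt) _.
by apply: ltnW; apply: cnt_lt => //; rewrite eq_sym.
Qed.

Lemma mem_subtree_core v : (forall w, edge v w -> cnt [set v] w <= cnt [set w] v) ->
  v \in subtree_core G.
Proof.
move=> h; rewrite inE; apply/forallP => z.
have [->//|/(side_nbr tG)[w]] := eqVneq z v.
by rewrite inE => vw; apply: num_subtrees_side => //; apply: h.
Qed.

End Counting.

(** * Rooted binary branches of a tree *)

Lemma imset_setD (T T' : finType) (f : T -> T') (A B : {set T}) : injective f ->
  f @: (A :\: B) = f @: A :\: f @: B.
Proof.
move=> fI; apply/setP => y; apply/imsetP/setDP => [[x /setDP[xA xB] ->]|[]].
  by rewrite !mem_imset.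
by case/imsetP=> x xA ->; rewrite mem_imset // => xB; exists x => //; apply/setDP.
Qed.

Inductive btree := Leaf | Node of btree & btree.

(** The number of subtrees through the root: each child is either omitted or contributes a subtree
    through it. *)
Fixpoint rcount t := if t is Node a b then (rcount a).+1 * (rcount b).+1 else 1.

Fixpoint height t := if t is Node a b then (maxn (height a) (height b)).+1 else 0.

Fixpoint nverts t := if t is Node a b then (nverts a + nverts b).+1 else 1.

(** A caterpillar seen from one end: [j] spine vertices carrying a leaf each, with [t] attached
    after the last one. *)
Definition comb j t := iter j (Node Leaf) t.

(* The component of u after deletion of the edges to X, rooted at u, is a
   rooted binary tree of shape t. *)
Inductive hang (G : sgraph) : {set G} -> G -> btree -> Prop :=
| HangLeaf X u : nbrs u :\: X = set0 -> hang X u Leaf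
| HangNode X u w1 w2 a b : nbrs u :\: X = [set w1; w2] -> w1 != w2 ->
    hang [set u] w1 a -> hang [set u] w2 b -> hang X u (Node a b).

Section Hang.
Variable G : sgraph.
Implicit Types (u v w x y z : G) (X : {set G}) (t a b c : btree).

Lemma hang_node_inv X u a b : hang X u (Node a b) ->
  exists w1 w2, [/\ nbrs u :\: X = [set w1; w2], w1 != w2,
    hang [set u] w1 a & hang [set u] w2 b].
Proof. by move=> h; inversion h; exists w1, w2; subst. Qed.

Lemma hang_swap X u a b : hang X u (Node a b) -> hang X u (Node b a).
Proof.
move=> /hang_node_inv[w1 [w2 [e w12 h1 h2]]].
by apply: (@HangNode _ _ _ w2 w1); rewrite 1?setUC 1?eq_sym.
Qed.

Lemma nbrsD_edge u X w1 w2 : nbrs u :\: X = [set w1; w2] -> edge u w1 /\ edge u w2.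
Proof.
move=> e; have: w1 \in nbrs u :\: X by rewrite e set21.
have: w2 \in nbrs u :\: X by rewrite e set22.
by rewrite !inE => /andP[_ ->] /andP[_ ->].
Qed.

Lemma nbrsD_mem u v w1 w2 w : nbrs u :\ v = [set w1; w2] -> edge u w ->
  [\/ w = v, w = w1 | w = w2].
Proof.
move=> e uw; have [->|wv] := eqVneq w v; first by constructor 1.
have: w \in nbrs u :\ v by rewrite !inE wv.
by rewrite e => /set2P[]->; [constructor 2|constructor 3].
Qed.

Lemma nbrsD_exchange u v w1 w2 : edge u v -> nbrs u :\ v = [set w1; w2] -> w1 != w2 ->
  nbrs u :\ w1 = [set v; w2] /\ v != w2.
Proof.
move=> uv e w12; have [u1 u2] := nbrsD_edge e.
have vw : v \notin [set w1; w2] by rewrite -e !inE eqxx.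
have v2 : v != w2 by apply: contraNneq vw => ->; exact: set22.
split=> //; apply/setP => x; apply/setD1P/set2P => [[x1]|].
  by rewrite inE => /(nbrsD_mem e)[xv|x1'|x2]; [left|case/eqP: x1|right].
rewrite [x \in _]inE => -[]->; split=> //; last by rewrite eq_sym.
by apply: contraNneq vw => ->; exact: set21.
Qed.

Lemma cnt_leaf X u : nbrs u :\: X = set0 -> X \subset nbrs u -> cnt X u = 1.
Proof.
move=> e sX; suff -> : X = nbrs u by apply: cnt_nbrs.
by apply/eqP; rewrite eqEsubset sX -setD_eq0 e eqxx.
Qed.

(** Re-rooting: seen from one child, the branches at [u] are the other child and whatever lies
    behind [v]. This gives the shapes on both sides of the next edge. *)
Lemma hang_shift u v a b c : edge u v -> hang [set v] u (Node a b) -> hang [set u] v c ->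
  exists w1 w2, [/\ nbrs u :\ v = [set w1; w2], w1 != w2,
    hang [set u] w1 a, hang [set u] w2 b &
    hang [set w1] u (Node b c) /\ hang [set w2] u (Node a c)].
Proof.
move=> uv /hang_node_inv[w1 [w2 [e w12 h1 h2]]] hv; exists w1, w2; split=> //.
have [e1 v2] := nbrsD_exchange uv e w12.
have e' : nbrs u :\ v = [set w2; w1] by rewrite setUC.
have w21 : w2 != w1 by rewrite eq_sym.
have [e2 v1] := nbrsD_exchange uv e' w21.
split; first by apply: (@HangNode _ _ _ w2 v); rewrite 1?setUC // eq_sym.
by apply: (@HangNode _ _ _ w1 v); rewrite 1?setUC // eq_sym.
Qed.

Hypothesis tG : treelike G.

Lemma cnt_node X u w1 w2 : X \subset nbrs u -> nbrs u :\: X = [set w1; w2] -> w1 != w2 ->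
  cnt X u = (cnt [set u] w1).+1 * (cnt [set u] w2).+1.
Proof.
move=> sX e w12.
have m1 : w1 \in nbrs u :\: X by rewrite e set21.
have m2 : w2 \in nbrs u :\: X by rewrite e set22.
have s1 : w1 |: X \subset nbrs u by rewrite subUset sub1set sX andbT; case/setDP: m1.
rewrite (cnt_split tG sX m1) (cnt_split tG s1 (w := w2)); last first.
  by move: m2; rewrite !inE eq_sym negb_or w12.
rewrite cnt_leaf ?mul1n 1?mulnC //.
  apply/setP => x; move/setP/(_ x): e; rewrite !inE.
  by case: (x == w1); case: (x == w2); case: (x \in X).
by rewrite subUset s1 sub1set andbT; case/setDP: m2.
Qed.

Lemma hang_cnt X u t : X \subset nbrs u -> hang X u t -> cnt X u = rcount t.
Proof.
move=> + h; elim: h => {X u t} [X u e|X u w1 w2 a b e w12 _ IH1 _ IH2] sX.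
  exact: cnt_leaf.
have [u1 u2] := nbrsD_edge e.
by rewrite (cnt_node sX e w12) IH1 ?IH2 // sub1set inE edge_sym.
Qed.

Lemma hang_cnt1 u v t : edge u v -> hang [set v] u t -> cnt [set v] u = rcount t.
Proof. by move=> uv; apply: hang_cnt; rewrite sub1set inE. Qed.

Lemma branch_node X u w1 w2 x : X \subset nbrs u -> nbrs u :\: X = [set w1; w2] ->
  (x \in branch X u) = [|| x == u, x \in side w1 u | x \in side w2 u].
Proof.
move=> sX e; apply/(branchP tG _ sX)/or3P => [[->|[w]]|].
- by rewrite eqxx; constructor 1.
- by rewrite e => /set2P[]->; [constructor 2|constructor 3].
case=> [/eqP->|xw|xw]; [by left|right..].
  by exists w1; rewrite // e set21.
by exists w2; rewrite // e set22.
Qed.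

Lemma branch_leaf X u : X \subset nbrs u -> nbrs u :\: X = set0 -> branch X u = [set u].
Proof.
move=> sX e; apply/setP => x; apply/(branchP tG _ sX)/set1P => [[//|[w]]|->]; last by left.
by rewrite e inE.
Qed.

Lemma hang_dist_le X u t x : X \subset nbrs u -> hang X u t -> x \in branch X u ->
  dist x u <= height t.
Proof.
move=> + h; elim: h x => {X u t} [X u e|X u w1 w2 a b e w12 _ IH1 _ IH2] x sX.
  by rewrite branch_leaf // => /set1P->; rewrite distxx.
have [u1 u2] := nbrsD_edge e.
rewrite (branch_node _ sX e) => /or3P[/eqP->|xw|xw]; first by rewrite distxx.
  rewrite (dist_side tG _ xw) 1?edge_sym //= ltnS leq_max IH1 ?branch1 //.
  by rewrite sub1set inE edge_sym.
rewrite (dist_side tG _ xw) 1?edge_sym //= ltnS leq_max IH2 ?branch1 ?orbT //.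
by rewrite sub1set inE edge_sym.
Qed.

Lemma hang_deep X u t : X \subset nbrs u -> hang X u t ->
  exists2 x, x \in branch X u & dist x u = height t.
Proof.
move=> + h; elim: h => {X u t} [X u e|X u w1 w2 a b e w12 _ IH1 _ IH2] sX.
  by exists u; rewrite ?distxx // branch_leaf // set11.
have [u1 u2] := nbrsD_edge e.
have s1 : [set u] \subset nbrs w1 by rewrite sub1set inE edge_sym.
have s2 : [set u] \subset nbrs w2 by rewrite sub1set inE edge_sym.
have [x1 + d1] := IH1 s1; have [x2 + d2] := IH2 s2; rewrite !branch1 => m2 m1.
have [le|le] := leqP (height a) (height b).
  exists x2; first by rewrite (branch_node _ sX e) m2 !orbT.
  by rewrite (dist_side tG _ m2) 1?edge_sym //= d2 (maxn_idPr le).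
exists x1; first by rewrite (branch_node _ sX e) m1 !orbT.
by rewrite (dist_side tG _ m1) 1?edge_sym //= d1 (maxn_idPl (ltnW le)).
Qed.

Lemma hang_card X u t : X \subset nbrs u -> hang X u t -> #|branch X u| = nverts t.
Proof.
move=> + h; elim: h => {X u t} [X u e|X u w1 w2 a b e w12 _ IH1 _ IH2] sX.
  by rewrite branch_leaf // cards1.
have [u1 u2] := nbrsD_edge e.
have [u1' u2'] : edge w1 u /\ edge w2 u by rewrite ![edge _ u]edge_sym.
rewrite /= -IH1 ?sub1set ?inE // -IH2 ?sub1set ?inE // !branch1.
have -> : branch X u = u |: (side w1 u :|: side w2 u).
  by apply/setP => x; rewrite (branch_node _ sX e) !in_setU in_set1.
rewrite cardsU1 in_setU !(negbTE (notin_side tG _)) //= add1n cardsU.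
suff -> : side w1 u :&: side w2 u = set0 by rewrite cards0 subn0.
apply/eqP; rewrite setI_eq0; apply/pred0P => x; apply/negP => /andP[/= x1 x2].
by have := side_disjoint tG u1 u2 w12 x1; rewrite x2.
Qed.

Lemma degreeE u : degree u = #|nbrs u|. Proof. by []. Qed.

Lemma hang_exists u v : edge u v ->
  (forall x, x \in side u v -> degree x = 1 \/ degree x = 3) ->
  exists t, hang [set v] u t.
Proof.
have [n] := ubnP #|side u v|; elim: n u v => // n IH u v; rewrite ltnS => sz uv deg.
have dv : #|nbrs u| = #|nbrs u :\ v|.+1 by rewrite (cardsD1 v) inE uv.
have := deg u (side_refl _ _); rewrite degreeE dv => -[[/eqP]|[/eqP]].
  by rewrite cards_eq0 => /eqP e; exists Leaf; apply: HangLeaf.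
case/cards2P=> w1 [w2 [w12 e]].
have step w : w \in nbrs u :\ v -> exists t, hang [set u] w t.
  rewrite !inE => /andP[wv uw]; have sub := side_mono tG uw uv wv.
  apply: IH => [||x xw]; [|by rewrite edge_sym|by apply: deg; apply: (subsetP sub)].
  apply: leq_trans sz; apply: proper_card; rewrite properE sub.
  apply/subsetPn; exists u; rewrite ?side_refl //.
  by apply: notin_side; rewrite // edge_sym.
have [|a ha] := step w1; first by rewrite e set21.
have [|b hb] := step w2; first by rewrite e set22.
by exists (Node a b); apply: HangNode e w12 ha hb.
Qed.

(** Neighbourhoods have to agree only on the branch itself. In a glued tree only the glued point
    gets new neighbours, so branches avoiding it keep their shape. *)
Lemma hang_transfer (G' : sgraph) (f : G -> G') u v t : injective f -> edge u v ->
  (forall x, x \in side u v -> nbrs (f x) = f @: nbrs x) ->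
  hang [set v] u t -> hang [set f v] (f u) t.
Proof.
move=> fI uv nb; move eX: [set v] => X h.
elim: h v uv nb eX => {X u t} [X u e|X u w1 w2 a b e w12 _ IH1 _ IH2] v uv nb eX; subst X.
  by apply: HangLeaf; rewrite nb ?side_refl // -imset_set1 -imset_setD // e imset0.
have [u1 u2] := nbrsD_edge e.
have ne w : w \in [set w1; w2] -> w != v by rewrite -e => /setD1P[].
apply: (@HangNode _ _ _ (f w1) (f w2)).
- rewrite nb ?side_refl // -imset_set1 -imset_setD //.
  by rewrite e imsetU !imset_set1.
- by rewrite (inj_eq fI).
- apply: IH1 => // [|x xw]; first by rewrite edge_sym.
  by apply: nb; apply: (subsetP (side_mono tG u1 uv (ne _ (set21 _ _)))).
apply: IH2 => // [|x xw]; first by rewrite edge_sym.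
by apply: nb; apply: (subsetP (side_mono tG u2 uv (ne _ (set22 _ _)))).
Qed.

Lemma subtree_core_node u v a b c : edge u v -> hang [set v] u (Node a b) ->
  hang [set u] v c -> rcount c <= rcount (Node a b) ->
  rcount a <= rcount (Node b c) -> rcount b <= rcount (Node a c) -> u \in subtree_core G.
Proof.
move=> uv hu hv cc ca cb; have [w1 [w2 [e w12 h1 h2 [k1 k2]]]] := hang_shift uv hu hv.
have [u1 u2] := nbrsD_edge e.
apply: mem_subtree_core => // w /(nbrsD_mem e)[]->.
- by rewrite (hang_cnt1 uv hu) (hang_cnt1 _ hv) // edge_sym.
- by rewrite (hang_cnt1 u1 k1) (hang_cnt1 _ h1) // edge_sym.
by rewrite (hang_cnt1 u2 k2) (hang_cnt1 _ h2) // edge_sym.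
Qed.

Lemma subtree_core_side u v a c : edge u v -> hang [set v] u a -> hang [set u] v c ->
  rcount c < rcount a -> subtree_core G \subset side u v.
Proof.
move=> uv hu hv lt; apply/subsetP => z; apply: contraLR => zs.
rewrite inE negb_forall; apply/existsP; exists u; rewrite -ltnNge.
apply: (num_subtrees_side_lt tG uv); last by rewrite (mem_side tG _ uv).
by rewrite (hang_cnt1 uv hu) (hang_cnt1 _ hv) // edge_sym.
Qed.

End Hang.

(** Iterates [hang_shift] along the spine: each step transfers one leaf from the comb ahead to the
    tree behind. *)
Lemma comb_spine (G : sgraph) j (u v : G) s : edge u v -> hang [set v] u s ->
  hang [set u] v (comb j Leaf) ->
  exists2 f : nat -> G, f 0 = u & forall i, i <= j ->
    [/\ edge (f i) (f i.+1), hang [set f i.+1] (f i) (comb i s)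
      & hang [set f i] (f i.+1) (comb (j - i) Leaf)].
Proof.
elim: j u v s => [|j IH] u v s uv hu hv.
  by exists (fun i => if i is 0 then u else v) => // -[].
have vu : edge v u by rewrite edge_sym.
have [w1 [w2 [e w12 _ h2 [_ k2]]]] := hang_shift vu hv hu.
have [_ vw] := nbrsD_edge e.
have [f f0 fP] := IH v w2 (Node Leaf s) vw k2 h2.
exists (fun i => if i is i'.+1 then f i' else u) => // -[|i] ij.
  by rewrite f0.
by have := fP i ij; rewrite /comb -iterSr.
Qed.

(** Since 2 (r + 1) + 2 = 2 (r + 2), the shift by two turns the recursion into a doubling. *)
Lemma count_comb i t : (rcount (comb i t)).+2 = 2 ^ i * (rcount t).+2.
Proof. by elim: i => [|i IH]; rewrite ?mul1n //= expnS -mulnA -IH; lia. Qed.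

Lemma height_comb i t : height (comb i t) = i + height t.
Proof. by elim: i => //= i ->; rewrite max0n. Qed.

Lemma nverts_comb i : nverts (comb i Leaf) = i.*2.+1.
Proof. by elim: i => //= i ->; rewrite doubleS. Qed.

(** * Gluing two trees at a vertex *)

Section Glue.
Variables K H : pointed_graph.

Notation T := (identify_points K H).

Definition glue_left (x : K) : T := inl x.

(** Sending the dropped point of [H] to the point of [K] makes this an embedding of all of [H],
    symmetric to [glue_left]. *)
Definition glue_right (y : H) : T :=
  if insub y is Some z then inr z else inl (point K).

Lemma glue_right_point : glue_right (point H) = glue_left (point K).
Proof. by rewrite /glue_right insubF // eqxx. Qed.

Lemma glue_right_val (z : {y : H | y != point H}) : glue_right (val z) = inr z.
Proof. by rewrite /glue_right valK. Qed.

Lemma glue_right_cases (y : H) :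
  y = point H \/ exists2 z : {y : H | y != point H}, y = val z & glue_right y = inr z.
Proof.
have [->|yp] := eqVneq y (point H); [by left|right].
exists (exist _ y yp) => //; exact: (glue_right_val (exist _ y yp)).
Qed.

Lemma glue_left_inj : injective glue_left.
Proof. by move=> x y []. Qed.

Lemma glue_right_inj : injective glue_right.
Proof.
move=> x y; case: (glue_right_cases x) => [->|[x' -> ->]];
  case: (glue_right_cases y) => [->|[y' -> ->]]; rewrite ?glue_right_point //.
by move=> [->].
Qed.

Lemma edge_glue_left x y : edge (glue_left x) (glue_left y) = edge x y.
Proof. by []. Qed.

Lemma edge_glue_right x y : edge (glue_right x) (glue_right y) = edge x y.
Proof.
case: (glue_right_cases x) => [->|[x' -> ->]];
  case: (glue_right_cases y) => [->|[y' -> ->]]; rewrite ?glue_right_point //.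
- by rewrite !edge_irr.
- by rewrite [LHS]/= eqxx.
by rewrite [LHS]/= eqxx [RHS]edge_sym.
Qed.

Lemma edge_glue_mixed x y : y != point H ->
  edge (glue_left x) (glue_right y) = (x == point K) && edge (point H) y.
Proof. by case: (glue_right_cases y) => [->|[y' -> ->] _ //]; rewrite eqxx. Qed.

Lemma glueP (z : T) :
  (exists x, z = glue_left x) \/ exists2 y, y != point H & z = glue_right y.
Proof.
case: z => [x|y]; [by left; exists x|right].
by exists (val y); [exact: (valP y)|rewrite glue_right_val].
Qed.

Lemma nbrs_glue_left x : x != point K -> nbrs (glue_left x) = glue_left @: nbrs x.
Proof.
move=> xp; apply/setP => z; rewrite inE; case: (glueP z) => [[x' ->]|[y yp ->]].
  by rewrite mem_imset ?inE //; exact: glue_left_inj.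
rewrite edge_glue_mixed // (negbTE xp); symmetry; apply/imsetP => -[x' _].
by case: (glue_right_cases y) yp => [->|[y' _ ->] //]; rewrite eqxx.
Qed.

Lemma nbrs_glue_right y : y != point H -> nbrs (glue_right y) = glue_right @: nbrs y.
Proof.
move=> yp; apply/setP => z; rewrite inE; case: (glueP z) => [[x ->]|[y' yp' ->]]; last first.
  by rewrite edge_glue_right mem_imset ?inE //; exact: glue_right_inj.
rewrite edge_sym edge_glue_mixed //; apply/andP/imsetP => [[/eqP-> e]|[y']].
  by exists (point H); rewrite ?inE 1?edge_sym // glue_right_point.
rewrite inE; case: (glue_right_cases y') => [-> e|[y'' _ -> //]].
by rewrite glue_right_point => /glue_left_inj ->; rewrite edge_sym.
Qed.

Lemma nbrs_glue_point :
  nbrs (glue_left (point K)) = glue_left @: nbrs (point K) :|: glue_right @: nbrs (point H).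
Proof.
apply/setP => z; rewrite inE in_setU; case: (glueP z) => [[x ->]|[y yp ->]].
  rewrite (mem_imset _ _ glue_left_inj) inE edge_glue_left; apply/idP/orP => [|[//|]].
    by left.
  case/imsetP=> y; rewrite inE; case: (glue_right_cases y) => [->|[y' _ -> //]].
  by rewrite edge_irr.
rewrite edge_glue_mixed // eqxx (mem_imset _ _ glue_right_inj) inE /=.
apply/idP/orP => [|[|//]]; first by right.
case/imsetP=> x _; case: (glue_right_cases y) yp => [->|[y' _ -> //]].
by rewrite eqxx.
Qed.

Hypotheses (tK : treelike K) (tH : treelike H).

Lemma treelike_glue : treelike T.
Proof.
have sub (G : sgraph) (f : G -> T) x y : (forall a b, edge a b -> edge (f a) (f b)) ->
    connect (@edge G) x y -> connect (@edge T) (f x) (f y).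
  move=> fe c; apply: (connect_invariant (P := fun a => connect (@edge T) (f x) (f a))) c _.
    by move=> a b ab h; apply: connect_trans h (connect1 (fe _ _ ab)).
  exact: connect0.
have cp z : connect (@edge T) (glue_left (point K)) z.
  case: (glueP z) => [[x ->]|[y _ ->]]; first by apply: sub; case: tK.
  rewrite -glue_right_point; apply: sub; last by case: tH.
  by move=> a b; rewrite edge_glue_right.
split=> [x y|u v uv].
  by apply: connect_trans (cp y); rewrite (sym_connect_sym (@edge_sym T)).
(* [Pl] and [Pr] project the glued tree onto one part and collapse the other part to its point. A
   walk avoiding an edge of one part projects to a walk avoiding it there. *)
pose Pl a b (z : T) := if z is inl x then x \in side a b else point K \in side a b.
pose Pr a b (z : T) := if z is inr y then val y \in side a b else point H \in side a b.
have Pr_right a b y : Pr a b (glue_right y) = (y \in side a b).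
  by case: (glue_right_cases y) => [->|[y' -> ->] //]; rewrite glue_right_point.
have left_left a b : edge a b -> glue_left b \notin side (glue_left a) (glue_left b).
  move=> ab; have nb := notin_side tK ab; rewrite inE; apply/negP => c.
  suff: Pl a b (glue_left b) by apply/negP.
  apply: (connect_invariant (P := Pl a b)) c (side_refl _ _).
  move=> [x|x] [y|y] //.
  - by move=> xy xs; exact: side_closed xs xy.
  - by case/andP => /andP[/eqP-> _] _.
  by case/andP => /andP[/eqP-> _] _.
have right_right a b : edge a b -> glue_right b \notin side (glue_right a) (glue_right b).
  move=> ab; have nb := notin_side tH ab; rewrite inE; apply/negP => c.
  suff: Pr a b (glue_right b) by rewrite Pr_right; apply/negP.
  have del c' d : del_edge (glue_right a) (glue_right b) (glue_right c') (glue_right d) ->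
      c' \in side a b -> d \in side a b.
    rewrite /del_edge edge_glue_right !(inj_eq glue_right_inj) => cd cs.
    exact: side_closed cs cd.
  apply: (connect_invariant (P := Pr a b)) c _; last by rewrite Pr_right side_refl.
  move=> [x|x] [y|y] // xy.
  - move: (xy) => /andP[/andP[/eqP ex _] _]; subst x; move: xy.
    by rewrite -(glue_right_val y) -/(glue_left _) -glue_right_point !Pr_right => /del.
  - move: (xy) => /andP[/andP[/eqP ey _] _]; subst y; move: xy.
    by rewrite -(glue_right_val x) -/(glue_left _) -glue_right_point !Pr_right => /del.
  by move: xy; rewrite -(glue_right_val x) -(glue_right_val y) !Pr_right => /del.
move: uv; case: (glueP u) => [[a ->]|[a ap ->]]; case: (glueP v) => [[b ->]|[b bp ->]].
- exact: left_left.
- by rewrite edge_glue_mixed // => /andP[/eqP-> ?]; rewrite -glue_right_point; apply: right_right.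
- rewrite edge_sym edge_glue_mixed // => /andP[/eqP-> ?]; rewrite -glue_right_point.
  by apply: right_right; rewrite edge_sym.
by rewrite edge_glue_right; apply: right_right.
Qed.

Lemma hang_glue v1 a b c : nbrs (point K) = [set v1] -> hang [set point K] v1 c ->
  hang set0 (point H) (Node a b) ->
  [/\ edge (glue_left (point K)) (glue_left v1),
      hang [set glue_left v1] (glue_left (point K)) (Node a b)
    & hang [set glue_left (point K)] (glue_left v1) c].
Proof.
move=> nK hK /hang_node_inv[w1 [w2 [nH w12 h1 h2]]].
have kv : edge (point K) v1 by have := set11 v1; rewrite -nK inE.
have [e1 e2] := nbrsD_edge nH.
have right_shape w t : edge (point H) w -> hang [set point H] w t ->
    hang [set glue_left (point K)] (glue_right w) t.
  move=> ew hw; rewrite -glue_right_point; apply: (hang_transfer tH glue_right_inj) hw.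
    by rewrite edge_sym.
  move=> x xw; apply: nbrs_glue_right; apply: contraTneq xw => ->.
  by apply: notin_side; rewrite // edge_sym.
split=> //.
  apply: (@HangNode _ _ _ (glue_right w1) (glue_right w2)).
  - rewrite nbrs_glue_point nK imset_set1 setUC setDUl setDv setU0.
    rewrite setD0 in nH; rewrite nH imsetU !imset_set1.
    apply/setDidPl; rewrite disjoint_sym disjoints1 in_set2.
    have ne w : edge (point H) w -> glue_left v1 != glue_right w.
      by case: (glue_right_cases w) => [->|[w' _ -> //]]; rewrite edge_irr.
    by rewrite !(negbTE (ne _ _)).
  - by rewrite (inj_eq glue_right_inj).
  - exact: right_shape.
  exact: right_shape.
apply: (hang_transfer tK glue_left_inj) hK; first by rewrite edge_sym.
move=> x xv; apply: nbrs_glue_left; apply: contraTneq xv => ->.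
by apply: notin_side; rewrite // edge_sym.
Qed.

End Glue.

(** * Shapes of rgood trees *)

(* Shapes of rgood trees whose levels 0, ..., k are full and which have p
   vertices with children on level k; rgcount k p is their rcount. *)
Inductive rgshape : nat -> nat -> btree -> Prop :=
| Rgshape00 : rgshape 0 0 Leaf
| Rgshape01 : rgshape 0 1 (Node Leaf Leaf)
| RgshapeS k p q a b : rgshape k p a -> rgshape k q b ->
    [|| p == 0, p == 2 ^ k, q == 0 | q == 2 ^ k] ->
    rgshape k.+1 (p + q) (Node a b).

Fixpoint rgcount k p :=
  if k is k'.+1
  then (rgcount k' (minn p (2 ^ k'))).+1 * (rgcount k' (p - 2 ^ k')).+1
  else if p == 0 then 1 else 4.

Lemma rgshape_le k p t : rgshape k p t -> p <= 2 ^ k.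
Proof. by elim=> // {}k {}p q a b _ pk _ qk _; rewrite expnS; lia. Qed.

Lemma rgshape_height k p t : rgshape k p t -> height t = k + (0 < p).
Proof. by elim=> // {}k {}p q a b _ /= -> _ -> h; have := expn_gt0 2 k; lia. Qed.

Lemma rgshape_nverts k p t : rgshape k p t -> (nverts t).+1 = 2 ^ k.+1 + p.*2.
Proof. by elim=> // {}k {}p q a b _ /= ea _ eb _; rewrite expnS; lia. Qed.

(** One child is empty or full on its last level, so up to order the two numbers are the minimum of
    their sum with 2^k and the remainder. *)
Lemma rgshape_count k p t : rgshape k p t -> rcount t = rgcount k p.
Proof.
elim=> // {}k {}p q a b ha /= -> hb -> h.
have pk := rgshape_le ha; have qk := rgshape_le hb.
have [[-> ->]|[-> ->]] : minn (p + q) (2 ^ k) = p /\ p + q - 2 ^ k = q \/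
    minn (p + q) (2 ^ k) = q /\ p + q - 2 ^ k = p by lia.
  by [].
exact: mulnC.
Qed.

Section Rgood.
Variable T : pointed_graph.
Hypothesis tT : treelike T.
Implicit Types u v w x y z : T.
Local Notation r := (point T).
Local Notation h := (@highest_level T).
Hypothesis root_degree : degree r = 2.
Hypothesis inner_degree : forall v, v != r -> degree v = 1 \/ degree v = 3.
Hypothesis pendant_level : forall u v, pendant u -> pendant v -> level u <= (level v).+1.

Lemma level_highest v : level v <= h.
Proof. exact: (@leq_bigmax _ (@level T)). Qed.

Lemma highest_attained : exists v, level v = h.
Proof.
have [v e] := eq_bigmax (@level T) (ltac:(by apply/card_gt0P; exists r) : 0 < #|T|).
by exists v; rewrite /highest_level e.
Qed.

Lemma level_side u w : edge u w -> r \in side u w -> level w = (level u).+1.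
Proof. exact: dist_side. Qed.

Lemma level_root : level r = 0.
Proof. exact: distxx. Qed.

Lemma parent_side x : x != r -> exists2 v, edge x v & r \in side v x.
Proof.
rewrite eq_sym => /(side_nbr tT)[v]; rewrite inE => xv rv; by exists v.
Qed.

Lemma root_side u v w : edge u v -> r \in side v u -> edge u w -> w != v -> r \in side u w.
Proof. by move=> uv rv uw wv; apply: (subsetP (side_mono tT uv uw _)) rv; rewrite eq_sym. Qed.

Lemma side_neq_root u v : edge u v -> r \in side v u -> u != r.
Proof.
by move=> uv rv; apply: contraTneq rv => <-; apply: notin_side; rewrite // edge_sym.
Qed.

Lemma nonpendant_child u v : edge u v -> r \in side v u -> ~~ pendant u ->
  exists w1 w2, nbrs u :\ v = [set w1; w2] /\ w1 != w2.
Proof.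
move=> uv rv np; have [d1|] := inner_degree (side_neq_root uv rv).
  by rewrite /pendant d1 in np.
rewrite degreeE (cardsD1 v) inE uv => -[/eqP/cards2P[w1 [w2 [w12 e]]]].
by exists w1, w2.
Qed.

Lemma highest_pendant z : z != r -> level z = h -> pendant z.
Proof.
move=> zr zh; have [v zv rv] := parent_side zr; apply/negPn/negP => np.
have [w1 [w2 [e w12]]] := nonpendant_child zv rv np.
have zw : edge z w1 by case: (nbrsD_edge e).
have wv : w1 != v by have := set21 w1 w2; rewrite -e => /setD1P[].
have := level_highest w1.
by rewrite (level_side zw (root_side zv rv zw wv)) zh ltnn.
Qed.

Lemma pendant_low x : pendant x -> h <= (level x).+1.
Proof.
have [z zh] := highest_attained; have [zr|zr] := eqVneq z r.
  by rewrite -zh zr level_root.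
by rewrite -zh => px; apply: pendant_level => //; apply: highest_pendant.
Qed.

Lemma top_pendant_parentE x : x != r -> (level x).+1 = h ->
  top_pendant_parent x = ~~ pendant x.
Proof.
move=> xr xh; have [v xv rv] := parent_side xr; have lx := level_side _ rv.
rewrite edge_sym in lx; apply/existsP/idP => [[z /and3P[_ _ /andP[xz /eqP lz]]]|np].
  apply/negP => /eqP; rewrite degreeE => /eqP/cards1P[y e].
  have: v \in nbrs x by rewrite inE.
  have: z \in nbrs x by rewrite inE.
  by rewrite e => /set1P zy /set1P vy; move: lz; rewrite lx // zy vy; lia.
have [w1 [w2 [e w12]]] := nonpendant_child xv rv np.
have xw : edge x w1 by case: (nbrsD_edge e).
have wv : w1 != v by have := set21 w1 w2; rewrite -e => /setD1P[].
have rx := root_side xv rv xw wv; have lw := level_side xw rx.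
exists w1; rewrite /parent xw lw xh !eqxx !andbT; apply: highest_pendant; last by rewrite lw.
by apply: side_neq_root (rx); rewrite edge_sym.
Qed.

Lemma level_in_side u w x : edge u w -> r \in side u w -> x \in side w u ->
  level x = level w + dist w x.
Proof.
by move=> uw ru xw; rewrite (level_side uw ru) /level (dist_cross tT uw ru xw) addn1.
Qed.

Variable le : rel T.
Hypothesis le_order : tree_order le.

(** [tree_order] compares vertices with different parents as their parents. Going up one level at a
    time, the parents stay distinct, since the sides of the siblings are disjoint, until [w] and
    [w'] are reached. *)
Lemma le_siblings u w w' x y : edge u w -> edge u w' -> w != w' ->
  r \in side u w -> r \in side u w' -> le w w' ->
  x \in side w u -> y \in side w' u -> level x = level y -> le x y.
Proof.
move=> uw uw' ww' ru ru' leww'.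
have lw := level_side uw ru; have lw' := level_side uw' ru'.
have up v z : edge u v -> r \in side u v -> z \in side v u -> level v < level z ->
    exists z', [/\ z' \in side v u, parent z' z & level z = (level z').+1].
  move=> uv ruv zv lt; have zr : z != r.
    by apply: contraTneq zv => ->; rewrite (mem_side tT _ uv) negbK.
  have [z' zz' rz'] := parent_side zr; have z'z : edge z' z by rewrite edge_sym.
  have lz := level_side z'z rz'; exists z'; split=> //; last by rewrite /parent z'z lz /=.
  apply/negPn/negP => no; have [zv' _] := side_cross zz' zv no.
  by rewrite zv' ltnn in lt.
have [n] := ubnP (level x); elim: n x y => // n IH x y; rewrite ltnS => xn xw yw lxy.
have [lt|ge] := ltnP (level w) (level x); last first.
  have ex := level_in_side uw ru xw; have ey := level_in_side uw' ru' yw.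
  suff [<- <-] : w = x /\ w' = y by [].
  by split; apply: (dist0_eq tT); move: ge lxy; rewrite ex ey lw lw'; clear; lia.
have [x' [xw' px lx]] := up _ _ uw ru xw lt.
have lt' : level w' < level y by rewrite -lxy lw' -lw.
have [y' [yw' py ly]] := up _ _ uw' ru' yw lt'.
have lxy' : level x' = level y' by move: lxy; rewrite lx ly => -[].
have x'0 : 0 < level x' by move: lt; rewrite lx lw; clear; lia.
have x'y' : x' != y'.
  by apply: contraTneq (xw') => ->; apply: contraL yw'; apply: side_disjoint.
have ly' : level y = (level x').+1 by rewrite ly lxy'.
rewrite (le_order.2 _ _ _ _ _ x'0 lx ly' px py x'y').
by apply: IH => //; rewrite -lx.
Qed.

Hypothesis le_final : forall u v, (level u).+1 = h -> (level v).+1 = h ->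
  le u v -> top_pendant_parent u -> top_pendant_parent v.

(** One vertex with children below the smaller sibling precedes all vertices of its level below the
    larger one, and the final-segment condition gives all of these children. *)
Lemma siblings_full u w w' : edge u w -> edge u w' -> w != w' ->
  r \in side u w -> r \in side u w' -> le w w' ->
  (forall x, x \in side w u -> (level x).+1 = h -> pendant x) \/
  (forall y, y \in side w' u -> (level y).+1 = h -> ~~ pendant y).
Proof.
move=> uw uw' ww' ru ru' leww'.
have nr v z : edge u v -> r \in side u v -> z \in side v u -> z != r.
  by move=> uv ruv; apply: contraTneq => ->; rewrite (mem_side tT _ uv) negbK.
have [/existsP[x /and3P[xw /eqP xh np]]|none] :=
    boolP [exists x, [&& x \in side w u, (level x).+1 == h & ~~ pendant x]].
  right=> y yw yh; rewrite -top_pendant_parentE ?(nr _ _ uw' ru' yw) //.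
  apply: (le_final xh yh); last by rewrite top_pendant_parentE ?(nr _ _ uw ru xw).
  by apply: (le_siblings uw uw') xw yw _ => //; move: xh yh; clear; lia.
left=> x xw xh; apply: contraNT none => np.
by apply/existsP; exists x; rewrite xw xh eqxx.
Qed.

(** A shape does not tell which vertices of the tree are pendant. The last two clauses record enough
    of this to turn [siblings_full] into the side condition of [RgshapeS]. *)
Definition branch_rgshape k u v p t := [/\ rgshape k p t, hang [set v] u t,
  (forall x, x \in side u v -> (level x).+1 = h -> pendant x) -> p = 0
  & (forall x, x \in side u v -> (level x).+1 = h -> ~~ pendant x) -> p = 2 ^ k].

Lemma merge_rgshape k u w w' p q a b : edge u w -> edge u w' -> w != w' ->
  r \in side u w -> r \in side u w' ->
  branch_rgshape k w u p a -> branch_rgshape k w' u q b ->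
  rgshape k.+1 (p + q) (Node a b).
Proof.
move=> uw uw' ww' ru ru' [ha _ a0 a1] [hb _ b0 b1]; apply: RgshapeS => //.
have lw := level_side uw ru; have lw' := level_side uw' ru'.
have [tot _ _] := le_order.1 (level u).+1 isT.
have /orP[l|l] := tot w w' (introT eqP lw) (introT eqP lw').
  by case: (siblings_full uw uw' ww' ru ru' l) => [/a0|/b1] ->; rewrite eqxx ?orbT.
rewrite eq_sym in ww'.
by case: (siblings_full uw' uw ww' ru' ru l) => [/b0|/a1] ->; rewrite eqxx ?orbT.
Qed.

Lemma branch_rgshape_exists k u v : edge u v -> r \in side v u -> level u + k.+1 = h ->
  exists p t, branch_rgshape k u v p t.
Proof.
elim: k u v => [|k IH] u v uv rv uh.
  have uh' : (level u).+1 = h by rewrite -addn1.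
  have [pu|np] := boolP (pendant u).
    exists 0, Leaf; split=> //; first exact: Rgshape00; last first.
      by move/(_ u (side_refl _ _) uh'); rewrite pu.
    apply: HangLeaf; apply/eqP; rewrite -cards_eq0 -(eqn_add2l (v \in nbrs u)) -cardsD1.
    by rewrite inE uv; exact: pu.
  have [w1 [w2 [e w12]]] := nonpendant_child uv rv np.
  have [u1 u2] := nbrsD_edge e.
  have leaf w : w \in nbrs u :\ v -> hang [set u] w Leaf.
    rewrite !inE => /andP[wv uw]; have ru := root_side uv rv uw wv.
    have wu : edge w u by rewrite edge_sym.
    have pw : pendant w.
      by apply: highest_pendant; [apply: side_neq_root wu ru|rewrite (level_side uw ru)].
    apply: HangLeaf; apply/eqP; rewrite -cards_eq0 -(eqn_add2l (u \in nbrs w)) -cardsD1.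
    by rewrite inE wu; exact: pw.
  exists 1, (Node Leaf Leaf); split=> //; first exact: Rgshape01.
    by apply: (HangNode e w12); apply: leaf; rewrite e ?set21 ?set22.
  by move/(_ u (side_refl _ _) uh'); rewrite (negbTE np).
have np : ~~ pendant u by apply/negP => /pendant_low; rewrite -uh; clear; lia.
have [w1 [w2 [e w12]]] := nonpendant_child uv rv np.
have [u1 u2] := nbrsD_edge e.
have wv w : w \in [set w1; w2] -> w != v by rewrite -e => /setD1P[].
have [v1 v2] := (wv _ (set21 _ _), wv _ (set22 _ _)).
have ru1 := root_side uv rv u1 v1; have ru2 := root_side uv rv u2 v2.
have l1 := level_side u1 ru1; have l2 := level_side u2 ru2.
have [|||p [a ha]] := IH w1 u; [by rewrite edge_sym|by []|by rewrite l1 -uh addSnnS|].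
have [|||q [b hb]] := IH w2 u; [by rewrite edge_sym|by []|by rewrite l2 -uh addSnnS|].
have m := merge_rgshape u1 u2 w12 ru1 ru2 ha hb.
exists (p + q), (Node a b).
have s1 := subsetP (side_mono tT u1 uv v1); have s2 := subsetP (side_mono tT u2 uv v2).
case: ha => _ ha a0 a1; case: hb => _ hb b0 b1; split=> //.
- exact: HangNode e w12 ha hb.
- by move=> al; rewrite a0 ?b0 // => x xs; apply: al; auto.
by move=> al; rewrite a1 ?b1 ?addnn -?mul2n -?expnS // => x xs; apply: al; auto.
Qed.

Lemma root_rgshape : exists k p t, [/\ 0 < p, rgshape k p t & hang set0 r t].
Proof.
have /eqP/cards2P[w1 [w2 [w12 e]]] := root_degree.
have e' : nbrs r :\: set0 = [set w1; w2] by rewrite setD0.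
have [u1 u2] := nbrsD_edge e'.
have l1 := level_side u1 (side_refl _ _); have l2 := level_side u2 (side_refl _ _).
rewrite level_root in l1 l2; have [h1 h2] := (level_highest w1, level_highest w2).
case eh : h => [|[|k]]; first by rewrite l1 eh in h1.
  have leaf w : edge r w -> level w = 1 -> hang [set r] w Leaf.
    move=> uw lw; have wu : edge w r by rewrite edge_sym.
    have pw : pendant w.
      by apply: highest_pendant; [apply: edge_neq|rewrite lw].
    apply: HangLeaf; apply/eqP; rewrite -cards_eq0 -(eqn_add2l (r \in nbrs w)) -cardsD1.
    by rewrite inE wu; exact: pw.
  exists 0, 1, (Node Leaf Leaf); split; [by []|exact: Rgshape01|].
  by apply: (HangNode e' w12); apply: leaf.
have [|||p [a ha]] := @branch_rgshape_exists k w1 r;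
  [by rewrite edge_sym|exact: side_refl|by rewrite l1 eh|].
have [|||q [b hb]] := @branch_rgshape_exists k w2 r;
  [by rewrite edge_sym|exact: side_refl|by rewrite l2 eh|].
have m := merge_rgshape u1 u2 w12 (side_refl _ _) (side_refl _ _) ha hb.
exists k.+1, (p + q), (Node a b).
case: ha => _ ha _ _; case: hb => _ hb _ _.
have hr : hang set0 r (Node a b) by apply: HangNode e' w12 ha hb.
(* If the sum were 0, the shape would have height [k.+1], below the attained highest level
   [k.+2]. *)
split=> //; have [z zh] := highest_attained.
have := hang_dist_le tT (sub0set _) hr (x := z); rewrite branch0 inE => /(_ isT).
by rewrite dist_sym // -/(level z) zh eh (rgshape_height m); case: (p + q) => //; clear; lia.
Qed.

End Rgood.

Lemma rgood_rgshape (T : pointed_graph) : rgood T ->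
  treelike T /\ exists k p t, [/\ #|T| = 1 \/ 0 < p, rgshape k p t & hang set0 (point T) t].
Proof.
case=> -[/is_tree_treelike tT degs] pl [le ord fin]; split=> //.
case: degs => [c1|[d2 d13]]; last first.
  have [k [p [t [p0 rt ht]]]] := root_rgshape tT d2 d13 pl ord fin.
  by exists k, p, t; split=> //; right.
exists 0, 0, Leaf; split; [by left|exact: Rgshape00|].
apply: HangLeaf; rewrite setD0; apply/setP => x; rewrite !inE.
have /eqP/cards1P[y e] : #|[set: T]| = 1 by rewrite cardsT.
have : x \in [set: T] by [].
have : point T \in [set: T] by [].
by rewrite e => /set1P-> /set1P->; rewrite edge_irr.
Qed.

(** * Shapes of binary caterpillars *)

Section Caterpillar.
Variable G : sgraph.
Hypothesis tG : treelike G.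
Implicit Types (u v w x y z : G) (s : seq G).

Lemma sorted_one_side u w s : edge u w -> sorted (@edge G) s -> u \notin s ->
  exists2 w', edge u w' & {subset s <= side w' u}.
Proof.
move=> uw; case: s => [_ _|x p]; first by exists w.
rewrite inE negb_or eq_sym => /= pp /andP[xu up].
have [w' + xw'] := side_nbr tG xu; rewrite inE => uw'; exists w' => //.
elim: p x pp up xw' {xu} => [|y p IH] x /=; first by move=> _ _ xw z; rewrite mem_seq1 => /eqP->.
move=> /andP[xy yp]; rewrite inE negb_or => /andP[uy up] xw.
have yw : y \in side w' u.
  by apply/negPn/negP => no; have [_ yu] := side_cross xy xw no; rewrite yu eqxx in uy.
by move=> z; rewrite inE => /predU1P[->//|]; apply: IH.
Qed.

(** Deleting [u] cuts a path into at most two pieces, each inside one branch at [u], so three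
    branches cannot all be met. *)
Lemma sorted_three_sides u w1 w2 w3 y1 y2 y3 s : sorted (@edge G) s -> uniq s ->
  edge u w1 -> edge u w2 -> edge u w3 -> w1 != w2 -> w1 != w3 -> w2 != w3 ->
  y1 \in side w1 u -> y2 \in side w2 u -> y3 \in side w3 u ->
  ~ [/\ y1 \in s, y2 \in s & y3 \in s].
Proof.
move=> ss us u1 u2 u3 n12 n13 n23 y1w y2w y3w [y1s y2s y3s].
have side_uniq w w' y : edge u w -> edge u w' -> y \in side w u -> y \in side w' u -> w = w'.
  by move=> uw uw' yw; apply: contraTeq => ww'; apply: side_disjoint yw.
have [wa [wb [ua ub sab]]] : exists wa wb, [/\ edge u wa, edge u wb &
    forall y, y \in s -> [\/ y = u, y \in side wa u | y \in side wb u]].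
  have [us'|us'] := boolP (u \in s); last first.
    have [w uw sw] := sorted_one_side u1 ss us'.
    by exists w, w; split=> // y /sw; constructor 2.
  case/splitPr: us' ss us => s1 s2 ss; rewrite cat_uniq /= negb_or => /and4P[_ /andP[n1 _] n2 _].
  have [ss1 /path_sorted ss2] := cat_sorted2 ss.
  have [wa ua sa] := sorted_one_side u1 ss1 n1.
  have [wb ub sb] := sorted_one_side u1 ss2 n2.
  exists wa, wb; split=> // y; rewrite mem_cat inE => /or3P[/sa|/eqP|/sb];
    by [constructor 1|constructor 2|constructor 3].
have loc w y : edge u w -> y \in side w u -> y \in s -> w = wa \/ w = wb.
  move=> uw yw /sab[yu|ya|yb]; [|left|right].
  - by move: yw; rewrite yu (negbTE (notin_side tG _)) // edge_sym.
  - exact: side_uniq yw ya.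
  exact: side_uniq yw yb.
move: n12 n13 n23.
by case: (loc _ _ u1 y1w y1s) (loc _ _ u2 y2w y2s) (loc _ _ u3 y3w y3s) =>
  [] -> [] -> [] ->; rewrite eqxx ?andbF.
Qed.

Variable s : seq G.
Hypotheses (s_path : sorted (@edge G) s) (s_uniq : uniq s)
  (s_dom : forall v, v \notin s -> exists2 u, u \in s & edge u v).

Lemma spine_meets_side u w v : edge u w -> v \in side w u -> v != w ->
  exists2 y, y \in s & y \in side w u.
Proof.
move=> uw vw ne; have [vs|/s_dom[y ys yv]] := boolP (v \in s); first by exists v.
exists y => //; apply/negPn/negP => no; rewrite edge_sym in yv.
by have [ev _] := side_cross yv vw no; rewrite ev eqxx in ne.
Qed.

(* If e + 1 + height t is the diameter, then a branch of positive height at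
   every neighbour of u would make u the centre of a spider with three legs of
   length 2, and no path of G dominates such a spider. *)
Lemma hang_comb u v t e z : edge u v -> hang [set v] u t ->
  z \in side v u -> dist z v = e -> (forall x y, dist x y <= e + 1 + height t) ->
  hang [set v] u (comb (height t) Leaf).
Proof.
elim: t u v e z => [//|a IHa b IHb] u v e z.
wlog le : a b IHa IHb / height a <= height b.
  move=> W uv /hang_swap hu zv dz diam; have [le|le] := leqP (height a) (height b).
    by apply: W le uv (hang_swap hu) zv dz diam.
  have := W b a IHb IHa (ltnW le) uv hu zv dz.
  by rewrite /= maxnC; apply.
move=> uv hu zv dz diam; have [w1 [w2 [e12 w12 h1 h2]]] := hang_node_inv hu.
have [u1 u2] := nbrsD_edge e12.
have wv w : w \in [set w1; w2] -> w != v by rewrite -e12 => /setD1P[].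
have [v1 v2] := (wv _ (set21 _ _), wv _ (set22 _ _)).
have [u1' u2'] : edge w1 u /\ edge w2 u by rewrite ![edge _ u]edge_sym.
have [s1 s2] : [set u] \subset nbrs w1 /\ [set u] \subset nbrs w2.
  by rewrite !sub1set !inE.
have [x1 + d1] := hang_deep tG s1 h1; have [x2 + d2] := hang_deep tG s2 h2.
rewrite !branch1 => m2 m1.
have m2' : x2 \in side u w1.
  by apply: (subsetP (side_mono tG u2 u1 _)) m2; rewrite eq_sym.
(* The deepest vertices below the two children are no farther apart than the assumed diameter bound.
   So if [a] has positive height, then so does the part behind [v], and there are three long
   legs. *)
have ha : height a <= e.
  have := diam x1 x2; rewrite (dist_cross tG u1' m1 m2') d1 (dist_sym tG u x2).
  by rewrite (dist_side tG u2' m2) d2 /= (maxn_idPr le); clear; lia.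
have a0 : height a = 0.
  apply/eqP; rewrite -leqn0 leqNgt; apply/negP => a0.
  have [|y3 y3s y3w] := spine_meets_side uv zv.
    by apply/negP => /eqP zv'; move: ha a0; rewrite -dz zv' distxx; clear; lia.
  have [|y1 y1s y1w] := spine_meets_side u1 m1.
    by apply/negP => /eqP x1'; move: a0; rewrite -d1 x1' distxx.
  have [|y2 y2s y2w] := spine_meets_side u2 m2.
    by apply/negP => /eqP x2'; move: le a0; rewrite -d2 x2' distxx; clear; lia.
  exact: (sorted_three_sides s_path s_uniq u1 u2 uv w12 v1 v2 y1w y2w y3w).
have ea : a = Leaf by case: (a) a0.
rewrite /= a0 max0n; subst a; apply: HangNode e12 w12 h1 _.
apply: (IHb w2 u e.+1 z) => //.
- by apply: (subsetP (side_mono tG uv u2 _)) zv; rewrite eq_sym.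
- by rewrite (dist_side tG _ zv) ?dz // edge_sym.
by move=> x y; have := diam x y; rewrite /= max0n; clear; lia.
Qed.

End Caterpillar.

Lemma caterpillar_comb (K : pointed_graph) j : binary_caterpillar K -> #|K| = j.*2.+2 ->
  (forall v : K, ecc v <= ecc (point K)) ->
  treelike K /\ exists2 w, nbrs (point K) = [set w] & hang [set point K] w (comb j Leaf).
Proof.
case=> -[/is_tree_treelike tK deg] [x0 [p0 [pp0 up0 dom]]] cK eccK; split=> //.
set p := point K in eccK *.
have [x xp] : exists x, x != p.
  have: 0 < #|predC1 p| by rewrite cardC1 cK.
  by move/card_gt0P=> [x]; rewrite inE => xp; exists x.
have [y ey] : exists y, dist y p = ecc p.
  have [//|y e] := eq_bigmax (fun y => dist y p) (_ : 0 < #|K|); first by rewrite cK.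
  by exists y; rewrite /ecc e.
have yp : y != p.
  apply: contraNneq xp => yp; have := leq_ecc x p.
  rewrite -ey yp distxx leqn0 => /eqP d0.
  by rewrite (dist0_eq tK d0).
have [w + yw] := side_nbr tK yp; rewrite inE => pw; have wp : edge w p by rewrite edge_sym.
(* A second neighbour of [p] would be farther from [y] than [p] is, against the maximality of
   [ecc p]. *)
have np : nbrs p = [set w].
  apply/setP => w'; rewrite !inE; apply/idP/eqP => [pw'|->//].
  apply/eqP/negPn/negP => ww'; rewrite eq_sym in ww'.
  have := eccK w'; rewrite leqNgt; case/negP; apply: leq_trans (leq_ecc y w').
  by rewrite (dist_side tK pw') ?ey // (subsetP (side_mono tK pw pw' ww')).
have [t ht] : exists t, hang [set p] w t.
  apply: hang_exists => // z _; have [/eqP|/deg] := boolP (pendant z); [by left|by right].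
have sw : [set p] \subset nbrs w by rewrite sub1set inE.
(* The far side of [w] consists of the pendant vertex [p] alone, so [hang_comb] is used with [e]
   equal to 0; the length [j] is then found by counting vertices. *)
have diam : forall a b : K, dist a b <= 0 + 1 + height t.
  move=> a b; apply: leq_trans (leq_ecc a b) _; apply: leq_trans (eccK b) _.
  rewrite -ey (dist_side tK wp yw) add0n add1n ltnS.
  by apply: (hang_dist_le tK sw ht); rewrite branch1.
have hc := hang_comb tK (s := x0 :: p0) pp0 up0 dom wp ht (side_refl _ _) (distxx _) diam.
exists w => //; suff <- : height t = j by [].
have := cardsC (side w p); rewrite -(side_compl tK wp) -!(branch1 w) (hang_card tK sw hc).
rewrite -(branch1 p) branch_leaf ?np ?setDv // cards1 nverts_comb cK; clear; lia.
Qed.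

(** * Center and subtree core of a crg tree *)

Lemma rcount_gt0 t : 0 < rcount t.
Proof. by case: t. Qed.

Lemma rgshape_inv k p a b : rgshape k.+1 p (Node a b) ->
  exists q q', [/\ rgshape k q a, rgshape k q' b, p = q + q' &
    [|| q == 0, q == 2 ^ k, q' == 0 | q' == 2 ^ k]].
Proof. by move=> h; inversion h; subst; exists p0, q. Qed.

Lemma rgshape_swap k p a b : rgshape k p (Node a b) -> rgshape k p (Node b a).
Proof.
case: k => [|k]; first by move=> h; inversion h; subst; exact: Rgshape01.
case/rgshape_inv=> q [q' [ha hb -> c]]; rewrite addnC; apply: RgshapeS => //; lia.
Qed.

(** * Estimates for the subtree counts of rgood shapes *)

Lemma rgcountS k p : rgcount k.+1 p =
  (rgcount k (minn p (2 ^ k))).+1 * (rgcount k (p - 2 ^ k)).+1.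
Proof. by []. Qed.

Lemma rgcountS0 k : rgcount k.+1 0 = (rgcount k 0).+1 * (rgcount k 0).+1.
Proof. by rewrite /= min0n. Qed.

(** The pairs (k, 2^k) and (k + 1, 0) describe the same full tree of height k + 1. *)
Lemma rgcount_full k : rgcount k (2 ^ k) = rgcount k.+1 0.
Proof.
elim: k => [//|k IH]; rewrite rgcountS0 -IH [LHS]/=.
have -> : minn (2 ^ k.+1) (2 ^ k) = 2 ^ k by rewrite expnS; lia.
by have -> : 2 ^ k.+1 - 2 ^ k = 2 ^ k by rewrite expnS; lia.
Qed.

Lemma rgcount0_gt0 k : 0 < rgcount k 0.
Proof. by case: k. Qed.

(** Only one factor of (x + 1)(y + 1) changes, and by induction x + 1 becomes at least 2x + 3. The
    surplus y + 1 is at least 2, which pays for the shift by two. *)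
Lemma rgcount_growth k p : p < 2 ^ k -> 2 * (rgcount k p).+2 <= (rgcount k p.+1).+2.
Proof.
elim: k p => [|k IH] p; first by rewrite expn0 ltnS leqn0 => /eqP->.
rewrite expnS => lt; rewrite !rgcountS; have [pk|pk] := ltnP p (2 ^ k).
  have -> : minn p.+1 (2 ^ k) = p.+1 by lia.
  have [-> ->] : p - 2 ^ k = 0 /\ p.+1 - 2 ^ k = 0 by lia.
  by have := IH p pk; have := rgcount0_gt0 k; nia.
have -> : minn p.+1 (2 ^ k) = 2 ^ k by lia.
rewrite subSn // rgcount_full.
have pk' : p - 2 ^ k < 2 ^ k by lia.
by have := IH _ pk'; have := rgcount0_gt0 k.+1; nia.
Qed.

Lemma rgcount_mono k p q : p <= q -> q <= 2 ^ k -> rgcount k p <= rgcount k q.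
Proof.
move=> pq; rewrite -(subnK pq); elim: (q - p) => // n IH nk.
by apply: leq_trans (IH _) _; [lia|have := rgcount_growth (p := n + p) nk; rewrite addSn; lia].
Qed.

Lemma rgshape_count_le k p t : rgshape k p t -> rcount t <= rgcount k.+1 0.
Proof.
move=> h; rewrite (rgshape_count h) -rgcount_full.
by apply: rgcount_mono => //; exact: rgshape_le h.
Qed.

Lemma rgshape_count_ge k p t : rgshape k p t -> rgcount k 0 <= rcount t.
Proof.
by move=> h; rewrite (rgshape_count h); apply: rgcount_mono => //; exact: rgshape_le h.
Qed.

Lemma rgshape_left_le k p a b : rgshape k p (Node a b) -> rcount a <= rgcount k 0.
Proof.
case: k => [|k] h; first by inversion h.
by have [q [q' [ha _ _ _]]] := rgshape_inv h; exact: rgshape_count_le ha.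
Qed.

Lemma rgshape_right_ge k p a b : rgshape k p (Node a b) -> rgcount k.-1 0 <= rcount b.
Proof.
case: k => [|k] h; first by inversion h.
by have [q [q' [_ hb _ _]]] := rgshape_inv h; exact: rgshape_count_ge hb.
Qed.

(** The bound is also a lower bound for the count of [b], by [rgshape_right_ge]. Hence the core
    never moves on from a child of the root to a grandchild. *)
Lemma rgshape_grandchildren_le k p a1 a2 b : rgshape k p (Node (Node a1 a2) b) ->
  rcount a1 <= rgcount k.-1 0 /\ rcount a2 <= rgcount k.-1 0.
Proof.
case: k => [|k] h; first by inversion h.
have [q [q' [ha _ _ _]]] := rgshape_inv h.
by split; [exact: rgshape_left_le ha|exact: rgshape_left_le (rgshape_swap ha)].
Qed.

Lemma rgshape_heights k p a b : rgshape k p (Node a b) -> 0 < p ->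
  height a <= k /\ k.*2 <= (height a + height b).+1.
Proof.
case: k => [|k] h; first by inversion h.
have [q [q' [ha hb -> c]]] := rgshape_inv h; move: c.
by rewrite (rgshape_height ha) (rgshape_height hb); have := expn_gt0 2 k; lia.
Qed.

Section SetDist.
Variable G : sgraph.

Lemma set_dist_le (X Y : {set G}) x y : x \in X -> y \in Y -> set_dist X Y <= dist x y.
Proof.
move=> xX yY; rewrite /set_dist.
apply: leq_trans (@Order.TotalTheory.bigmin_le_cond _ nat _ _ x (fun x => x \in X)
  (fun x => \big[minn/#|G|]_(y in Y) dist x y) xX) _.
exact: (@Order.TotalTheory.bigmin_le_cond _ nat _ _ y (fun y => y \in Y)
  (fun y => dist x y) yY).
Qed.

Lemma set_dist_ge (X Y : {set G}) b : b <= #|G| ->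
  (forall x y, x \in X -> y \in Y -> b <= dist x y) -> b <= set_dist X Y.
Proof.
move=> bG h; rewrite /set_dist.
apply: (big_ind (fun k => b <= k)) => // [k l|x xX]; first by rewrite leq_min => -> ->.
apply: (big_ind (fun k => b <= k)) => // [k l|y yY]; first by rewrite leq_min => -> ->.
exact: h.
Qed.

End SetDist.

(** * Bounds for the distance between center and core *)

Section Crg.
Variables (G : sgraph) (v0 v1 : G) (t : btree) (j k p : nat).
Hypotheses (tG : treelike G) (e01 : edge v0 v1) (hang0 : hang [set v1] v0 t)
  (hang1 : hang [set v0] v1 (comb j Leaf)) (t_rg : rgshape k p t) (p_gt0 : 0 < p).

Lemma hang_ecc_le (u v : G) a b : edge u v -> hang [set v] u a -> hang [set u] v b ->
  ecc u <= maxn (height a) (height b).+1.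
Proof.
move=> uv ha hb; apply/bigmax_leqP => x _.
have [su sv] : [set v] \subset nbrs u /\ [set u] \subset nbrs v.
  by rewrite !sub1set !inE uv edge_sym uv.
have [xu|xv] := boolP (x \in side u v).
  by rewrite leq_max (hang_dist_le tG su ha) // branch1.
rewrite -(mem_side tG _ uv) in xv; rewrite leq_max.
by rewrite (dist_side tG _ xv) 1?edge_sym // ltnS (hang_dist_le tG sv hb) ?branch1 ?orbT.
Qed.

Lemma long_dist (u v : G) a b : edge u v -> hang [set v] u a -> hang [set u] v b ->
  exists2 x, x \in side u v & exists2 y, y \in side v u &
    dist x y = (height a + height b).+1 /\ dist y v = height b.
Proof.
move=> uv ha hb.
have [su sv] : [set v] \subset nbrs u /\ [set u] \subset nbrs v.
  by rewrite !sub1set !inE uv edge_sym uv.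
have [x + dx] := hang_deep tG su ha; have [y + dy] := hang_deep tG sv hb.
rewrite !branch1 => ys xs; exists x => //; exists y => //; split=> //.
by rewrite (dist_cross tG uv xs ys) dx dist_sym // dy addn1 addSn.
Qed.

Lemma height_t : height t = k.+1.
Proof. by rewrite (rgshape_height t_rg) p_gt0 addn1. Qed.

Lemma t_node : exists a b, t = Node a b.
Proof. by case: t t_rg => [h|a b _]; [inversion h; subst|exists a, b]. Qed.

(** For j at most k the eccentricity of [v0] is at most k + 1, while its children already yield a
    distance of at least 2k + 1. *)
Lemma v0_center : j <= k -> v0 \in center G.
Proof.
move=> jk; have [a [b et]] := t_node; have h0 := hang0; rewrite et in h0.
have [w1 [w2 [e w12 ha hb [k1 k2]]]] := hang_shift e01 h0 hang1.
have [u1 u2] := nbrsD_edge e.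
have u1' : edge w1 v0 by rewrite edge_sym.
have [x xs [y ys [dxy _]]] := long_dist u1' ha k1.
apply: (mem_center tG (x := x) (y := y)); rewrite dxy.
have E := hang_ecc_le e01 hang0 hang1.
have h_rg := t_rg; rewrite et in h_rg; have [_ hh] := rgshape_heights h_rg p_gt0.
move: E; rewrite height_t /= height_comb addn0; move: hh jk; clear.
by move: (ecc v0) (height a) (height b) => *; lia.
Qed.

(** The witness is a vertex at the far end of the caterpillar; distances to it separate core and
    center. *)
Lemma far_dist : exists2 y,
  (forall x, x \in side v0 v1 -> j < dist x y) & forall x, dist x y <= ecc x.
Proof.
have [x _ [y ys [_ dy]]] := long_dist e01 hang0 hang1.
exists y => z; last by rewrite dist_sym // leq_ecc.
move=> zs; rewrite (dist_cross tG e01 zs ys) (dist_sym tG v1) dy height_comb addn0.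
by clear; lia.
Qed.

Variable f : nat -> G.
Hypotheses (f0 : f 0 = v0) (fP : forall i, i <= j ->
    [/\ edge (f i) (f i.+1), hang [set f i.+1] (f i) (comb i t)
      & hang [set f i] (f i.+1) (comb (j - i) Leaf)]).

Lemma spine_ecc i : i <= j -> ecc (f i) <= maxn (i + k.+1) (j - i).+1.
Proof.
move=> ij; have [e ha hb] := fP ij.
by have := hang_ecc_le e ha hb; rewrite !height_comb height_t addn0.
Qed.

(** Some distance equals j + k + 2, and [ecc (f i)] is at most the larger of i + k + 1 and j - i +
    1. For odd j - k two values of [i] balance these. *)
Lemma spine_center i : j - k <= i.*2.+1 -> i.*2 <= (j - k).+1 -> k <= j ->
  f i \in center G.
Proof.
move=> l1 l2 kj; have ij : i <= j by lia.
have [x _ [y _ [dxy _]]] := long_dist e01 hang0 hang1.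
apply: (mem_center tG (x := x) (y := y)); rewrite dxy height_t height_comb addn0.
by move: (spine_ecc ij) l1 l2 kj; move: (ecc _); clear; lia.
Qed.

Lemma spine_dist i n : i + n <= j.+1 -> dist (f i) (f (i + n)) <= n.
Proof.
elim: n => [|n IH] le; first by rewrite addn0 distxx.
apply: leq_trans (dist_triangle tG (f (i + n)) _ _) _; rewrite addnS in le *.
have [e _ _] := fP le.
by apply: leq_trans (leq_add (IH (ltnW le)) (dist_edge e)) _; rewrite addn1.
Qed.

(** Seen from the far end of the caterpillar, a core vertex is at distance at least j + 1, whereas a
    central vertex is within its eccentricity, which is at most j + 1 - (j - k)/2 if k is less than
    j. The triangle inequality does the rest. *)
Lemma ccd_ge : rcount (comb j Leaf) < rcount t -> (j - k)./2 <= center_core_dist G.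
Proof.
move=> lt; have core := subtree_core_side tG e01 hang0 hang1 lt.
have [y far ecy] := far_dist.
(* A lower bound for [set_dist] must not exceed its default value [#|G|]. *)
have jG : j < #|G| by apply: leq_trans (dist_le_card v0 y); apply: far; rewrite side_refl.
apply: set_dist_ge => [|x z xc zc]; first by lia.
have := far z (subsetP core z zc); have := dist_triangle tG x z y.
have [jk|jk] := leqP j k; first by have -> : j - k = 0 by lia.
have le : (j - k)./2 <= j by lia.
have Ei := spine_ecc le.
have : ecc x <= ecc (f (j - k)./2) by move: xc; rewrite inE => /forallP.
have := ecy x; rewrite (dist_sym tG z x); move: Ei jk.
move: (ecc x) (ecc _) (dist x y) (dist z y) (dist x z); clear.
by move=> *; lia.
Qed.

Lemma ccd_le_small_root : rcount t <= rcount (comb j Leaf) -> 3 * 2 ^ k.+1 <= (rcount t).+2 ->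
  exists s, 3 * 2 ^ j < 4 ^ s * (rcount t).+2 /\ center_core_dist G <= (j - k)./2 - s.
Proof.
(* [P s] is the inequality 2^s (r + 2) > 3 * 2^(j-s), with r the count of [t], multiplied by 2^s. At
   the least such [s], the count has stopped growing along the spine. *)
move=> le geR; pose P s := 3 * 2 ^ j < 4 ^ s * (rcount t).+2.
have four s : 4 ^ s = 2 ^ s * 2 ^ s by rewrite -expnMn.
have cmp s : s <= j -> P s = (rcount (comb (j - s) Leaf) < rcount (comb s t)).
  move=> sj; rewrite -(ltn_add2r 2) !addn2 !count_comb -(ltn_pmul2l (expn_gt0 2 s)).
  by rewrite mulnA -expnD subnKC // mulnA -four mulnC.
have Pj : P j.
  rewrite cmp // subnn -(ltn_add2r 2) !addn2 !count_comb expn0 mul1n /=.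
  have := expn_gt0 2 j; have := expn_gt0 2 k; move: geR; rewrite expnS; clear.
  by move: (2 ^ k) (2 ^ j) (rcount t) => *; nia.
have exP : exists s, P s by exists j.
case: (ex_minnP exP) => s Ps smin; exists s; split=> //.
have sj : s <= j by apply: smin.
have s0 : 0 < s.
  rewrite lt0n; apply: contraTneq Ps => ->.
  by rewrite cmp // subn0 -leqNgt.
have nP : ~~ P s.-1.
  by apply/negP => /smin; clear -s0; lia.
have s1j : s.-1 <= j by clear -sj; lia.
have core : f s \in subtree_core G.
  have [e ha hb] := fP sj.
  have es : comb s t = Node Leaf (comb s.-1 t) by rewrite -{1}(prednK s0).
  move: Ps; rewrite (cmp _ sj) => Ps.
  apply: (subtree_core_node tG e (a := Leaf) (b := comb s.-1 t)) hb _ _ _.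
  - by rewrite -es.
  - by rewrite -es ltnW.
  - exact: rcount_gt0.
  move: nP; rewrite (cmp _ s1j) -leqNgt.
  by have -> : j - s.-1 = (j - s).+1 by clear -s0 sj; lia.
(* Failure of [P] at s - 1 gives 2s at most j - k + 1. So [s] exceeds (j - k)/2 only when j - k is
   odd and [f s] is itself the second central vertex. *)
have kj : k.+1 + s.-1.*2 <= j.
  rewrite -(@leq_exp2l 2) // expnD -(@leq_pmul2l 3) // mulnA mulnC.
  have -> : 2 ^ s.-1.*2 = 4 ^ s.-1 by rewrite -muln2 mulnC expnM.
  by move: nP; rewrite /P -leqNgt; apply: leq_trans; rewrite leq_mul2l geR orbT.
have [sle|sgt] := leqP s (j - k)./2.
  have sc : f (j - k)./2 \in center G by apply: spine_center; clear -kj; lia.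
  apply: leq_trans (set_dist_le sc core) _; rewrite dist_sym //.
  by rewrite -{1}(subnKC sle) spine_dist // subnKC //; clear; lia.
have sc : f s \in center G by apply: spine_center; clear -kj s0 sgt; lia.
by apply: leq_trans (set_dist_le sc core) _; rewrite distxx.
Qed.

Lemma center_near_root : exists2 c, c \in center G & dist c v0 <= (j - k)./2.
Proof.
have [jk|kj] := leqP j k.
  by exists v0; [exact: v0_center|rewrite distxx].
exists (f (j - k)./2); first by apply: spine_center; clear -kj; lia.
rewrite dist_sym // -f0 -{1}[(j - k)./2]add0n spine_dist //.
by clear; lia.
Qed.

(** The case of a core vertex at the child carrying [a]. The last clause covers a shallow sibling
    and a short caterpillar, where that child is central as well. *)
Definition ccd_le_child a b := [/\ rgshape k p (Node a b),
  rcount (Node b (comb j Leaf)) < rcount a, center_core_dist G <= (j - k)./2.+1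
  & j < k -> height b < k -> center_core_dist G = 0].

Lemma child_core_ccd_le a b w : edge v0 w -> hang [set v0] w a ->
  hang [set w] v0 (Node b (comb j Leaf)) -> rgshape k p (Node a b) ->
  rcount (Node b (comb j Leaf)) < rcount a -> ccd_le_child a b.
Proof.
move=> vw ha hb rg lt; have wv : edge w v0 by rewrite edge_sym.
have [a1 [a2 ea]] : exists a1 a2, a = Node a1 a2.
  case: (a) lt => [|a1 a2 _]; last by exists a1, a2.
  by rewrite ltnNge rcount_gt0.
have core : w \in subtree_core G.
  have b_ge := rgshape_right_ge rg; have lt' := ltnW lt.
  rewrite ea in ha rg lt'.
  have [a1_le a2_le] := rgshape_grandchildren_le rg.
  apply: (subtree_core_node tG wv ha hb lt').
    by apply: leq_trans a1_le _; apply: leq_trans b_ge _; rewrite /=; clear; nia.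
  by apply: leq_trans a2_le _; apply: leq_trans b_ge _; rewrite /=; clear; nia.
split=> // [|jk bk].
  have [c cc dc] := center_near_root; apply: leq_trans (set_dist_le cc core) _.
  apply: leq_trans (dist_triangle tG v0 _ _) _; rewrite -addn1 leq_add //.
  exact: dist_edge.
suff wc : w \in center G.
  by apply/eqP; rewrite -leqn0; apply: leq_trans (set_dist_le wc core) _; rewrite distxx.
have [x xs [y ys [dxy _]]] := long_dist wv ha hb.
apply: (mem_center tG (x := x) (y := y)); rewrite dxy.
have [hl hh] := rgshape_heights rg p_gt0.
move: (hang_ecc_le wv ha hb) hl hh jk bk; rewrite /= height_comb addn0; clear.
by move: (ecc w) (height a) (height b) => *; lia.
Qed.

Lemma ccd_le_large_root : rcount (comb j Leaf) < rcount t ->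
  center_core_dist G <= (j - k)./2 \/ exists a b, ccd_le_child a b.
Proof.
have [a [b et]] := t_node; move: hang0 t_rg; rewrite et => h0 rg lt.
have [w1 [w2 [e w12 ha hb [k1 k2]]]] := hang_shift e01 h0 hang1.
have [u1 u2] := nbrsD_edge e.
have [la|la] := ltnP (rcount (Node b (comb j Leaf))) (rcount a).
  by right; exists a, b; apply: child_core_ccd_le u1 ha k1 rg la.
have [lb|lb] := ltnP (rcount (Node a (comb j Leaf))) (rcount b).
  right; exists b, a; apply: child_core_ccd_le u2 hb _ (rgshape_swap rg) lb.
  exact: k2.
left; have core : v0 \in subtree_core G.
  exact: (subtree_core_node tG e01 h0 hang1 (ltnW lt)).
have [c cc dc] := center_near_root.
by apply: leq_trans (set_dist_le cc core) _.
Qed.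

End Crg.

(** * The numbers R *)

Lemma rgood_nverts (T : pointed_graph) t : treelike T -> hang set0 (point T) t ->
  nverts t = #|T|.
Proof. by move=> tT /(hang_card tT (sub0set _)) <-; rewrite branch0 cardsT. Qed.

Lemma R_rcount l t : treelike (Trg l) -> hang set0 (point (Trg l)) t -> R l = rcount t.
Proof.
by move=> tT /(hang_cnt tT (sub0set _)) <-; rewrite /R num_subtreesE.
Qed.

Lemma Trg_rgshape q : exists k p t, [/\ treelike (Trg q.*2.+1), rgshape k p t,
  hang set0 (point (Trg q.*2.+1)) t, R q.*2.+1 = rcount t & q = 0 \/ 0 < p].
Proof.
have [|rg cT] := @TrgP q.*2.+1; first by rewrite /= odd_double.
have [tT [k [p [t [c1 rt ht]]]]] := rgood_rgshape rg; exists k, p, t; split=> //.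
  exact: R_rcount.
by case: c1; [rewrite cT; left; lia|right].
Qed.

(** Counting vertices gives q + 1 = 2^k + p with p between 1 and 2^k, which determines k. *)
Lemma Trg_rgshape_pos q : 0 < q -> exists p t, [/\ treelike (Trg q.*2.+1),
  rgshape (trunc_log 2 q) p t, hang set0 (point (Trg q.*2.+1)) t,
  R q.*2.+1 = rcount t & 0 < p /\ q.+1 = 2 ^ trunc_log 2 q + p].
Proof.
move=> q0; have [k [p [t [tT rt ht e]]]] := Trg_rgshape q; case=> [q0'|p0].
  by rewrite q0' in q0.
have := rgood_nverts tT ht; have [|_ ->] := @TrgP q.*2.+1; first by rewrite /= odd_double.
have pk := rgshape_le rt; have := rgshape_nverts rt; rewrite expnS => e1 e2.
have -> : trunc_log 2 q = k by apply: trunc_log_eq; rewrite // expnS; lia.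
by exists p, t; split=> //; split=> //; lia.
Qed.

Lemma R1 : R 1 = 1.
Proof.
have [k [p [t [tT _ ht -> _]]]] := Trg_rgshape 0.
have := rgood_nverts tT ht; have [|_ ->] := @TrgP 1; first by [].
case: t {ht} => // a b /=; have : 0 < nverts a by case: (a).
by clear; lia.
Qed.

Lemma R_rgcount q k p : q.+1 = 2 ^ k + p -> p <= 2 ^ k -> R q.*2.+1 = rgcount k p.
Proof.
case: (posnP q) => [->|q0] e pk.
  have [-> ->] : k = 0 /\ p = 0.
    by case: k e {pk} => [|k]; rewrite ?expnS; [|have := expn_gt0 2 k]; lia.
  exact: R1.
have [p' [t [_ rt _ -> [p0 e']]]] := Trg_rgshape_pos q0.
rewrite (rgshape_count rt); have := rgshape_le rt.
move: e'; move: (trunc_log 2 q) => k' e' pk' {rt t}.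
have [kk|kk|kk] := ltngtP k k'; last by subst k'; congr (rgcount k _); lia.
  have : 2 ^ k.+1 <= 2 ^ k' by rewrite leq_exp2l.
  by rewrite expnS; lia.
have : 2 ^ k'.+1 <= 2 ^ k by rewrite leq_exp2l.
rewrite expnS => le.
(* For different levels the two decompositions of q + 1 can only be the two descriptions of a full
   tree. *)
have [ep ep' e2] : [/\ p = 0, p' = 2 ^ k' & 2 ^ k = 2 ^ k'.+1] by rewrite expnS; split; lia.
have -> : k = k'.+1 by apply/eqP; rewrite -(@eqn_exp2l 2) // e2.
by rewrite ep ep' rgcount_full.
Qed.

Lemma R_growth q : 2 * (R q.*2.+1).+2 <= (R q.+1.*2.+1).+2.
Proof.
have le := trunc_logP (isT : 1 < 2) (ltn0Sn q); have lt := trunc_log_ltn q.+1 (isT : 1 < 2).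
rewrite expnS in lt; move: (trunc_log 2 q.+1) le lt => k le lt.
rewrite (@R_rgcount q k (q.+1 - 2 ^ k)); [|lia..].
rewrite (@R_rgcount q.+1 k (q.+1 - 2 ^ k).+1); [|lia..].
by apply: rgcount_growth; lia.
Qed.

Lemma R_growth_iter q i : 2 ^ i * (R q.*2.+1).+2 <= (R (q + i).*2.+1).+2.
Proof.
elim: i => [|i IH]; first by rewrite mul1n addn0.
by rewrite expnS -mulnA addnS; apply: leq_trans (R_growth _); rewrite leq_mul2l IH orbT.
Qed.

Lemma R_ge q : 3 * 2 ^ q <= (R q.*2.+1).+2.
Proof. by have := R_growth_iter 0 q; rewrite R1 add0n mulnC. Qed.

Lemma R_mono q q' : q <= q' -> R q.*2.+1 <= R q'.*2.+1.
Proof.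
move=> le; rewrite -(subnKC le).
by have := R_growth_iter q (q' - q); have := expn_gt0 2 (q' - q); nia.
Qed.

Lemma trunc_logS q : trunc_log 2 q.+1 <= (trunc_log 2 q).+1.
Proof.
rewrite -ltnS -(@ltn_exp2l 2) //; apply: leq_ltn_trans (trunc_logP _ _) _ => //.
have := trunc_log_ltn q (isT : 1 < 2); rewrite !expnS; lia.
Qed.

Lemma trunc_logD q i : trunc_log 2 (q + i) <= trunc_log 2 q + i.
Proof.
elim: i => [|i IH]; first by rewrite !addn0.
by rewrite !addnS; apply: leq_trans (trunc_logS _) _.
Qed.

Lemma trunc_log_lt q : 0 < q -> trunc_log 2 q < q.
Proof. by move=> q0; apply: leq_trans (trunc_logP (isT : 1 < 2) q0); apply: ltn_expl. Qed.

Section Tcrg.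
Variables (N q : nat).
Hypotheses (q_gt0 : 0 < q) (qN : q < N).
Local Notation j := (N - q.+1).
Local Notation k := (trunc_log 2 q).
Local Notation T := (Tcrg N.*2 q.*2.+1).

Lemma Tcrg_spine : treelike T /\ exists (v0 v1 : T) p t,
  [/\ edge v0 v1, hang [set v1] v0 t, hang [set v0] v1 (comb j Leaf), rgshape k p t
    & [/\ 0 < p, q.+1 = 2 ^ k + p & rcount t = R q.*2.+1]].
Proof.
have [p [t [tH rt ht eR [p0 eq]]]] := Trg_rgshape_pos q_gt0.
have ec : N.*2 - q.*2.+1 + 1 = j.*2.+2 by lia.
have [|cat_bin cat_card cat_ecc] := @caterpillarP j.*2.+2 _ isT.
  by rewrite /= odd_double.
have [tK [w nK hK]] := caterpillar_comb cat_bin cat_card cat_ecc.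
rewrite /Tcrg ec; split; first exact: treelike_glue.
have [a [b et]] := t_node rt p0; have ht' := ht; rewrite et in ht'.
have [e h0 h1] := hang_glue tK tH nK hK ht'.
exists (glue_left _ (point (caterpillar j.*2.+2))), (glue_left _ w), p, t.
by split=> //; rewrite et.
Qed.

Lemma comb_lt r : (rcount (comb j Leaf) < r) = (3 * 2 ^ j < r.+2).
Proof. by rewrite -(ltn_add2r 2) !addn2 count_comb mulnC. Qed.

Lemma Tcrg_ccd_ge : 3 * 2 ^ j < (R q.*2.+1).+2 -> (j - k)./2 <= center_core_dist T.
Proof.
have [tT [v0 [v1 [p [t [e h0 h1 rt [p0 eq <-]]]]]]] := Tcrg_spine.
rewrite -comb_lt => lt; have [f f0 fP] := comb_spine e h0 h1.
exact: (ccd_ge tT e h0 h1 rt p0 fP).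
Qed.

Lemma Tcrg_ccd_le_small_root : (R q.*2.+1).+2 <= 3 * 2 ^ j ->
  exists s, 3 * 2 ^ j < 4 ^ s * (R q.*2.+1).+2 /\ center_core_dist T <= (j - k)./2 - s.
Proof.
have geR := R_ge q; move: geR.
have [tT [v0 [v1 [p [t [e h0 h1 rt [p0 eq <-]]]]]]] := Tcrg_spine.
move=> geR; rewrite leqNgt -comb_lt -leqNgt => le.
have [f f0 fP] := comb_spine e h0 h1.
apply: (ccd_le_small_root tT e h0 h1 rt p0 fP le).
by apply: leq_trans geR; rewrite leq_mul2l leq_exp2l ?trunc_log_lt.
Qed.

Lemma Tcrg_ccd_le_large_root : 3 * 2 ^ j < (R q.*2.+1).+2 ->
  center_core_dist T <= (j - k)./2 \/
  exists a b, [/\ rgshape k (q.+1 - 2 ^ k) (Node a b),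
    (rcount b).+1 * (3 * 2 ^ j).-1 < rcount a, center_core_dist T <= (j - k)./2.+1
    & j < k -> height b < k -> center_core_dist T = 0].
Proof.
have [tT [v0 [v1 [p [t [e h0 h1 rt [p0 eq <-]]]]]]] := Tcrg_spine.
rewrite -comb_lt => lt; have [f f0 fP] := comb_spine e h0 h1.
have [le|[a [b [rg la le0 le1]]]] := ccd_le_large_root tT e h0 h1 rt p0 f0 fP lt; first by left.
right; exists a, b; split=> //; first by rewrite eq addKn.
by move: la; rewrite /=; have := count_comb j Leaf => /= ec; rewrite mulnC in ec; rewrite -ec.
Qed.

End Tcrg.

(** * Comparison of crg trees *)

(** Squaring overtakes doubling from k = 3 on. This confines the case where (j - k)/2 vanishes at
    the threshold to k at most 2. *)
Lemma rgcount0_large k : 3 <= k -> 3 * 2 ^ k.+2 < (rgcount k 0).+2.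
Proof.
elim: k => // k IH; rewrite leq_eqVlt => /predU1P[[<-] //|/IH].
rewrite rgcountS0 (expnS 2 k.+2); have := rgcount0_gt0 k; move: (rgcount k 0) (2 ^ k.+2).
by move=> x y; nia.
Qed.

Lemma rgcount0_eq1_or_ge4 k : rgcount k 0 = 1 \/ 4 <= rgcount k 0.
Proof.
by case: k => [|k]; [left|right; rewrite rgcountS0; have := rgcount0_gt0 k; nia].
Qed.

Lemma R_ge_full q : 0 < q -> rgcount (trunc_log 2 q) 0 <= R q.-1.*2.+1.
Proof.
move=> q0; have le := trunc_logP (isT : 1 < 2) q0; have gt := expn_gt0 2 (trunc_log 2 q).
rewrite -(@R_rgcount (2 ^ trunc_log 2 q).-1 (trunc_log 2 q) 0) //; last lia.
by apply: R_mono; lia.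
Qed.

(** With x = [rgcount k.-1 0], the larger child counts at most (x + 1)^2 and its sibling at least
    x. *)
Lemma rgshape_child_bound k p a b g : 0 < k -> rgshape k p (Node a b) ->
  (rcount b).+1 * g < rcount a -> g <= rgcount k.-1 0.
Proof.
case: k => // k _ rg lt; have := rgshape_left_le rg; have := rgshape_right_ge rg.
rewrite rgcountS0 /=; move: lt; move: (rcount a) (rcount b) (rgcount k 0) => A B x.
by clear; nia.
Qed.

(** A child has count 4, 10 or 25, according as none, one or both vertices of its level 1 have
    children. *)
Lemma rgshape2_children p a b : rgshape 2 p (Node a b) ->
  [\/ rcount a <= rcount b, p = 1 /\ rcount a <= 10 /\ 4 <= rcount b,
      p = 2 /\ rcount a = 25 /\ rcount b = 4 /\ height b = 1 |
      p = 3 /\ rcount a <= 25 /\ 10 <= rcount b].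
Proof.
case/rgshape_inv=> q [q' [ha hb ->]].
rewrite (rgshape_count ha) (rgshape_count hb) (rgshape_height hb).
move: (rgshape_le ha) (rgshape_le hb).
case: q {ha} => [|[|[|q]]] //; case: q' {hb} => [|[|[|q']]] // _ _ _;
  by [constructor 1|constructor 2|constructor 3|constructor 4].
Qed.

(** The last hypothesis gives N - q at most k + 2 for k = [trunc_log 2 q], while the tree just below
    the threshold contains the full tree of height k. By [rgcount0_large], k is at most 2, and
    finitely many pairs remain. *)
Lemma small_cases N q : 6 <= N -> 0 < q < N ->
  3 * 2 ^ (N - q.+1) < (R q.*2.+1).+2 -> (R q.-1.*2.+1).+2 <= 3 * 2 ^ (N - q) ->
  (N - q.+1 - trunc_log 2 q)./2 = 0 -> N = 6 /\ q = 3 \/ N = 8 /\ q = 4.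
Proof.
move=> N6 /andP[q0 qN] large small zero.
have full := R_ge_full q0; have lt := trunc_log_ltn q (isT : 1 < 2).
have jk : N - q <= (trunc_log 2 q).+2 by move: zero; clear; lia.
have k2 : trunc_log 2 q < 3.
  rewrite ltnNge; apply/negP => /rgcount0_large.
  have : 2 ^ (N - q) <= 2 ^ (trunc_log 2 q).+2 by rewrite leq_exp2l.
  by lia.
have q8 : q < 8.
  by apply: leq_trans lt _; rewrite (@leq_exp2l 2 _ 3).
have [v3 v4 v5 v6] : [/\ R 7 = 25, R 9 = 55, R 11 = 130 & R 13 = 286].
  by split; [apply: (@R_rgcount 3 2 0)|apply: (@R_rgcount 4 2 1)
    |apply: (@R_rgcount 5 2 2)|apply: (@R_rgcount 6 2 3)].
have [v1 v2] : R 3 = 4 /\ R 5 = 10.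
  by split; [apply: (@R_rgcount 1 0 1)|apply: (@R_rgcount 2 1 1)].
have [d eN] : exists d, N = q + d by exists (N - q); rewrite subnKC // ltnW.
move: q0 N6 large small jk {zero lt k2 full} qN.
subst N; rewrite subnS addKn.
case: q q8 => [|[|[|[|[|[|[|[|q]]]]]]]] // _; rewrite /= ?v1 ?v2 ?v3 ?v4 ?v5 ?v6 ?R1;
  by case: d => [|[|[|[|[|d]]]]] //=; auto.
Qed.

(* R l > 3 * 2 ^ ((n - l - 1) / 2) - 2 is only ever decided by l < n: the odd
   number n - 1 satisfies it, so neither the truncated subtraction nor the
   halving of the even number n - l - 1 loses anything. *)
Theorem theorem3p9 (n l : nat)
    (n_ge12 : 12 <= n) (n_even : ~~ odd n)
    (l_odd : odd l) (l_large : R l > 3 * 2 ^ (n - l - 1)./2 - 2)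
    (l_min : forall k : nat, odd k -> R k > 3 * 2 ^ (n - k - 1)./2 - 2 -> l <= k)
    (m : nat) (m_odd : odd m) (m_bounds : 3 <= m < n) :
  center_core_dist (Tcrg n m) <= center_core_dist (Tcrg n l).
Proof.
have [N eN] : exists N, n = N.*2 by exists n./2; lia.
have [a ea] : exists a, l = a.*2.+1 by exists l./2; lia.
have [q eq] : exists q, m = q.*2.+1 by exists m./2; lia.
subst n l m; have condE b : (3 * 2 ^ (N.*2 - b.*2.+1 - 1)./2 - 2 < R b.*2.+1) =
    (3 * 2 ^ (N - b.+1) < (R b.*2.+1).+2).
  have -> : (N.*2 - b.*2.+1 - 1)./2 = N - b.+1 by lia.
  by have := expn_gt0 2 (N - b.+1); lia.
rewrite condE in l_large.
have N6 : 6 <= N by lia.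
have small b : b < a -> (R b.*2.+1).+2 <= 3 * 2 ^ (N - b.+1).
  move=> ba; rewrite leqNgt -condE; apply/negP => /l_min.
  by rewrite /= odd_double => /(_ isT); lia.
have N5 : 2 ^ 5 <= 2 ^ N.-1 by rewrite leq_exp2l //; lia.
have aN : a < N.
  rewrite ltnNge; apply/negP => Na; have Na' : N.-1 < a by lia.
  have := small _ Na'; have -> : N - N.-1.+1 = 0 by lia.
  by have := R_ge N.-1; lia.
have a0 : 0 < a.
  by rewrite lt0n; apply: contraTneq l_large => ->; rewrite R1 subn1; lia.
have q0 : 0 < q by lia.
have qN : q < N by lia.
have lower := Tcrg_ccd_ge a0 aN l_large.
have a1a : a.-1.+1 = a by rewrite prednK.
have small1 : (R a.-1.*2.+1).+2 <= 3 * 2 ^ (N - a).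
  by have := small a.-1; rewrite a1a; apply.
have [qa|aq|->//] := ltngtP q a.
  have [s [s_large upper]] := Tcrg_ccd_le_small_root q0 qN (small q qa).
  have growth := R_growth_iter q (a.-1 - q).
  (* The index a - 1 is still below the threshold, so growth from q to a - 1 bounds [R q.*2.+1];
     with [s_large] this makes 4^s exceed 4^(a-1-q). *)
  have as_ : a.-1 - q < s.
    rewrite -(@ltn_exp2l 4) // -(@ltn_pmul2r (3 * 2 ^ (N - a))) ?muln_gt0 ?expn_gt0 //.
    have e : 2 ^ (N - q.+1) = 2 ^ (N - a) * 2 ^ (a.-1 - q).
      by rewrite -expnD; congr (2 ^ _); move: qa a1a aN; clear; lia.
    have e4 : 4 ^ (a.-1 - q) = 2 ^ (a.-1 - q) * 2 ^ (a.-1 - q) by rewrite -expnMn.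
    rewrite subnKC in growth; last by rewrite -ltnS a1a.
    rewrite e in s_large; rewrite e4.
    have le := leq_trans growth small1.
    have p0 := expn_gt0 2 (a.-1 - q).
    move: s_large le p0; clear.
    move: (2 ^ (a.-1 - q)) (2 ^ (N - a)) (4 ^ s) (R q.*2.+1).+2 => x y z w.
    by move=> h1 h2 h3; nia.
  (* Passing from a to q, j increases by a - q and k decreases by at most a - q. So (j - k)/2
     increases by at most a - q, which is at most [s]. *)
  apply: leq_trans upper _; apply: leq_trans _ lower.
  have := trunc_logD q (a - q); rewrite subnKC ?(ltnW qa) //.
  by move: as_ qa aN; clear; lia.
have q_large : 3 * 2 ^ (N - q.+1) < (R q.*2.+1).+2.
  have := R_mono (ltnW aq).
  have : 2 ^ (N - q.+1) <= 2 ^ (N - a.+1) by rewrite leq_exp2l //; move: aq; clear; lia.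
  by move: l_large; clear; lia.
have kk : trunc_log 2 a <= trunc_log 2 q by apply: leq_trunc_log; exact: ltnW.
have ii : (N - q.+1 - trunc_log 2 q)./2 <= (N - a.+1 - trunc_log 2 a)./2.
  by move: kk aq; clear; lia.
have [le|[s [t [rg lt le le0]]]] := Tcrg_ccd_le_large_root q0 qN q_large.
  exact: leq_trans le (leq_trans ii lower).
apply: leq_trans (_ : _ <= (N - a.+1 - trunc_log 2 a)./2) lower.
(* A strict drop of (j - k)/2 pays for the one step of the core into a child, so only equality is
   left. *)
move: ii; rewrite leq_eqVlt => /predU1P[ii|ii]; last exact: leq_trans le ii.
have [zero|pos] := posnP (N - a.+1 - trunc_log 2 a)./2.
  have aN' : 0 < a < N by rewrite a0.
  have [[eN ea]|[eN ea]] := small_cases N6 aN' l_large small1 zero; subst N a.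
    (* The factors 5, 2 and 11 below are 3 * 2^j - 1 for j = 1, 0 and 2. Only N = 6, q = 5 lets the
       core enter a child, with counts 25 and 4, and there that child is central too. *)
    have [eq|eq] : q = 4 \/ q = 5 by move: qN aq; clear; lia.
      subst q; have lt' : (rcount t).+1 * 5 < rcount s := lt.
      by case: (@rgshape2_children 1 _ _ rg); move: lt'; clear; lia.
    subst q; have lt' : (rcount t).+1 * 2 < rcount s := lt.
    case: (@rgshape2_children 2 _ _ rg) => [||[_ [_ [_ hb]]]|]; try by move: lt'; clear; lia.
    by rewrite le0 // hb.
  have [eq|[eq|eq]] : q = 5 \/ q = 6 \/ q = 7 by move: qN aq; clear; lia.
  - subst q; have lt' : (rcount t).+1 * 11 < rcount s := lt.
    by case: (@rgshape2_children 2 _ _ rg); move: lt'; clear; lia.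
  - subst q; have lt' : (rcount t).+1 * 5 < rcount s := lt.
    by case: (@rgshape2_children 3 _ _ rg); move: lt'; clear; lia.
  subst q; have lt' : (rcount t).+1 * 2 < rcount s := lt.
  by case: (@rgshape2_children 4 _ _ rg); move: lt'; clear; lia.
(* Equal positive halves allow a difference of at most one before halving, and q - a already uses it
   up. *)
have [eq ek] : q = a.+1 /\ trunc_log 2 q = trunc_log 2 a.
  by move: ii pos aq kk; clear; lia.
have k0 : 0 < trunc_log 2 q.
  by apply: leq_trans (leq_trunc_log 2 (_ : 2 <= q)); rewrite // eq ltnS.
have xg := rgshape_child_bound k0 rg lt.
have := R_ge_full a0; rewrite -ek => full.
have e2 : 2 ^ (N - a) = 4 * 2 ^ (N - q.+1).
  by rewrite -(expnD 2 2); congr (2 ^ _); move: eq qN; clear; lia.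
have y0 := expn_gt0 2 (N - q.+1).
move: xg full small1; rewrite e2; case: (trunc_log 2 q) k0 => // k _.
(* With x = [rgcount k 0] and y = 2^(N-q-1), one has 3y - 1 at most x, and (x + 1)^2 at most 12y -
   2, hence at most 4x + 2. So x is at most 2; [x4] excludes 2, and x = 1 contradicts 3y - 1 being
   at least 2. *)
rewrite rgcountS0 /=; have x4 := rgcount0_eq1_or_ge4 k.
move: x4 y0; move: (rgcount k 0) (2 ^ _) (R _) => x y r; clear.
by nia.
Qed.
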